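(* Let $n$ be a positive integer and $h:[n]\to[n]$ a Hessenberg function. Then there is an isomorphism of $\mathbb{C}$-algebras $$\Gamma(\mathcal{Z}(N,h)_e,\mathcal{O}_{\mathcal{Z}(N,h)_e})\;\cong\;\frac{\mathbb{C}[x_1,\ldots,x_n,\,q_{rs}\mid 2\le s\le n,\ n-h(n+1-s)<r<s]}{({}^hE_1^{(n)},\ldots,{}^hE_n^{(n)})}$$ which sends $x_{ij}$ to ${}^hE_{i-j}^{(n-j)}$ (for $1\le j<i\le n$) under the presentation $$\Gamma(\mathcal{Z}(N,h)_e,\mathcal{O}_{\mathcal{Z}(N,h)_e})\cong\mathbb{C}[x_{ij}\mid 1\le j<i\le n]/(F_{i,j}\mid j\in[n-1],\ h(j)<i\le n).$$ In particular, if $h$ is indecomposable, then there is an isomorphism of $\mathbb{C}$-algebras $$\mathbb{C}[\mathrm{Hess}(N,h)\cap\Omega_e^\circ]\;\cong\;\frac{\mathbb{C}[x_1,\ldots,x_n,\,q_{rs}\mid 2\le s\le n,\ n-h(n+1-s)<r<s]}{({}^hE_1^{(n)},\ldots,{}^hE_n^{(n)})}$$ which sends $x_{ij}$ to ${}^hE_{i-j}^{(n-j)}$ under the presentation $$\mathbb{C}[\mathrm{Hess}(N,h)\cap\Omega_e^\circ]=\mathbb{C}[x_{ij}\mid 1\le j<i\le n]/(F_{i,j}\mid j\in[n-2],\ h(j)<i\le n).$$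
   Context: Write $[n]=\{1,\ldots,n\}$. A Hessenberg function is a nondecreasing function $h:[n]\to[n]$ with $h(j)\ge j$ for all $j\in[n]$; it is indecomposable if $h(j)>j$ for all $j\in[n-1]$. Let $N$ be the $n\times n$ nilpotent matrix consisting of a single Jordan block ($N_{i,i+1}=1$, all other entries $0$). Let $g=(x_{ij})$ be the generic lower triangular unipotent $n\times n$ matrix: $x_{ii}=1$, $x_{ij}=0$ for $i<j$, and $x_{ij}$ ($1\le j<i\le n$) independent variables; let $v_1,\ldots,v_n$ be its columns. For $1\le j<i\le n$ put $$F_{i,j}=\det(v_1\,\ldots\,v_{i-1}\ Nv_j\ v_{i+1}\,\ldots\,v_n)\in\mathbb{C}[x_{ij}\mid 1\le j<i\le n],$$ which equals the entry $(g^{-1}Ng)_{ij}$. Set $$\mathcal{Z}(N,h)_e=\operatorname{Spec}\,\mathbb{C}[x_{ij}\mid 1\le j<i\le n]/((g^{-1}Ng)_{ij}\mid j\in[n-1],\ h(j)<i\le n).$$ $Fl(\mathbb{C}^n)\cong\mathrm{GL}_n(\mathbb{C})/B$ is the variety of full flags $V_\bullet$ in $\mathbb{C}^n$ ($B$ = upper triangular invertible matrices; the first $j$ columns of $g$ span $V_j$), $\mathrm{Hess}(N,h)=\{V_\bullet\in Fl(\mathbb{C}^n)\mid NV_i\subset V_{h(i)}\ \forall i\in[n]\}$ as a reduced closed subvariety, and $\Omega_e^\circ$ is the orbit of $eB$ under the lower triangular invertible matrices, an open affine subset identified with the lower triangular unipotent matrices (coordinates $x_{ij}$, $1\le j<i\le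 n$). For $1\le s\le n$ let $M_s$ be the $s\times s$ matrix with diagonal entries $x_1,\ldots,x_s$, entries $-1$ in positions $(i+1,i)$, entry $q_{kl}$ in position $(k,l)$ for $1\le k<l\le s$, and zeros elsewhere. Define $E_1^{(s)},\ldots,E_s^{(s)}$ by $\det(\lambda I_s-M_s)=\lambda^s-E_1^{(s)}\lambda^{s-1}+\cdots+(-1)^sE_s^{(s)}$. For $1\le i\le j\le n$, ${}^hE_i^{(j)}$ is obtained from $E_i^{(j)}$ by setting $q_{rs}=0$ for all $2\le s\le n$ and $1\le r\le n-h(n+1-s)$. *)

(* Defs.v *)
From HB Require Import structures.
From mathcomp Require Import all_boot all_order all_algebra.
From mathcomp Require Import boolp reals complex.
From mathcomp.multinomials Require Import mpoly.

Set Implicit Arguments.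
Unset Strict Implicit.
Unset Printing Implicit Defensive.

Import Order.TTheory GRing.Theory Num.Theory.

Local Open Scope ring_scope.
Local Open Scope quotient_scope.

(* Throughout, [n] = {1, ..., n} is represented by 'I_n, the index i of the   *)
(* mathematical text being the ordinal of value i - 1.  Thus "j in [n - 1]"   *)
(* reads j < n.-1, while comparisons between indices are unchanged.           *)

(* The library provides {ideal_quot I} as a commutative ring only; this is    *)
(* its K-algebra structure when I is an ideal of a K-algebra.                 *)
Section QuotientAlgebra.
Variables (K : comNzRingType) (A : comAlgType K) (I : idealr A).
Local Notation Q := {ideal_quot I}.

Definition proj : A -> Q := \pi_Q.

Definition quot_scale (k : K) (x : Q) : Q := \pi_Q (k%:A) * x.

Fact quot_scaleA a b v : quot_scale a (quot_scale b v) = quot_scale (a * b) v.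
Proof. by rewrite /quot_scale mulrA -rmorphM /= -scalerAl mul1r scalerA. Qed.
Fact quot_scale1 : left_id 1 quot_scale.
Proof. by move=> v; rewrite /quot_scale scale1r rmorph1 mul1r. Qed.
Fact quot_scaleDr : right_distributive quot_scale +%R.
Proof. by move=> a u v; rewrite /quot_scale mulrDr. Qed.
Fact quot_scaleDl v : {morph quot_scale^~ v : a b / a + b}.
Proof. by move=> a b; rewrite /quot_scale scalerDl rmorphD mulrDl. Qed.

HB.instance Definition _ := GRing.Zmodule_isLmodule.Build K Q
  quot_scaleA quot_scale1 quot_scaleDr quot_scaleDl.

Fact quot_scaleAl (k : K) (u v : Q) : k *: (u * v) = (k *: u) * v.
Proof. exact: mulrA. Qed.

HB.instance Definition _ := GRing.Lmodule_isLalgebra.Build K Q quot_scaleAl.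
HB.instance Definition _ := GRing.Lalgebra_isComAlgebra.Build K Q.

Fact proj_is_scalable : scalable proj.
Proof. by move=> k f; rewrite /proj -[f in LHS]mul1r scalerAl rmorphM. Qed.

HB.instance Definition _ := GRing.RMorphism.copy proj \pi_Q.
HB.instance Definition _ := GRing.isScalable.Build K A Q *:%R proj
  proj_is_scalable.

End QuotientAlgebra.

Arguments proj {K A} I f.

Section GeneratedIdeal.
Variables (A : comNzRingType) (T : finType) (P : pred T) (F : T -> A).

Definition gen_ideal : pred A :=
  fun f => `[< exists c : T -> A, f = \sum_(t | P t) c t * F t >].

Lemma gen_ideal_closed (L : nzRingType) (ev : {rmorphism A -> L}) :
  (forall t, P t -> ev (F t) = 0) -> idealr_closed gen_ideal.
Proof.
move=> evF; split.
- apply/asboolP; exists (fun=> 0); rewrite big1 // => t _; exact: mul0r.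
- apply/negP => /asboolP[c] /(congr1 ev) /eqP.
  rewrite rmorph1 rmorph_sum big1 ?oner_eq0 // => t Pt.
  by rewrite rmorphM evF ?mulr0.
- move=> a u v /asboolP[c ->] /asboolP[d ->]; apply/asboolP.
  exists (fun t => a * c t + d t); rewrite mulr_sumr -big_split /=.
  by apply: eq_bigr => t _; rewrite mulrDl mulrA.
Qed.

End GeneratedIdeal.

(* The polynomial ring in indeterminates indexed by a finite type T.          *)
Notation "{ 'mpolyT' K [ T ] }" := {mpoly K[#|T : finType|]}
  (at level 0, K at level 2, T at level 99, format "{ 'mpolyT'  K [ T ] }").

Definition varT (K : comNzRingType) (T : finType) (t : T) : {mpolyT K[T]} :=
  'X_(enum_rank t).

Definition evalT (K : comNzRingType) (T : finType) (a : T -> K)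
  : {mpolyT K[T]} -> K := meval (fun k => a (enum_val k)).

Definition substT (K : comNzRingType) (T U : finType) (s : T -> {mpolyT K[U]})
  : {mpolyT K[T]} -> {mpolyT K[U]} :=
  mmap (@mpolyC _ K) (fun k => s (enum_val k)).

HB.instance Definition _ (K : comNzRingType) (T : finType) (a : T -> K) :=
  GRing.LRMorphism.copy (evalT a) (meval (fun k => a (enum_val k))).
HB.instance Definition _ (K : comNzRingType) (T U : finType)
    (s : T -> {mpolyT K[U]}) := GRing.RMorphism.copy (substT s)
    (mmap (@mpolyC _ K) (fun k => s (enum_val k))).

Record hess_fun (n : nat) := HessFun {
  hess_val :> 'I_n -> 'I_n;
  hess_mono : forall i j : 'I_n, (i <= j)%N -> (hess_val i <= hess_val j)%N;
  hess_ge : forall j : 'I_n, (j <= hess_val j)%N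
}.

Definition indecomposable n (h : hess_fun n) : Prop :=
  forall j : 'I_n, (j < n.-1)%N -> (j < h j)%N.

Definition jordan (A : pzSemiRingType) n : 'M[A]_n :=
  \matrix_(i, j) (j == i.+1 :> nat)%:R.

(* The pair (i, j) indexes the variable x_{ij}.                               *)
Definition xvar n : finType := {p : 'I_n * 'I_n | (p.2 < p.1)%N}.

Definition unip (A : pzSemiRingType) n (a : xvar n -> A) : 'M[A]_n :=
  \matrix_(i, j)
    if (insub (i, j) : option (xvar n)) is Some t then a t else (i == j)%:R.

Section LowerUnipotentCoordinates.
Variables (C : fieldType) (n : nat).
Local Notation A := {mpolyT C[xvar n]}.

Definition xij (i j : 'I_n) (lt_ji : (j < i)%N) : A :=
  @varT C (xvar n) (exist _ (i, j) lt_ji).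

(* The generic matrix g.                                                      *)
Definition gen_unip : 'M[A]_n := unip (@varT C (xvar n)).

Definition F (i j : 'I_n) : A :=
  \det (\matrix_(k, l)
          if l == i then (jordan A n *m gen_unip) k j else gen_unip k l).

(* The ideal (F_{i,j} | j in [m], h(j) < i <= n).                             *)
Definition in_idealF (h : hess_fun n) (m : nat) : pred A :=
  gen_ideal (fun p : 'I_n * 'I_n => (p.2 < m)%N && (h p.2 < p.1)%N)
            (fun p => F p.1 p.2).

(* The ideal of Z(N, h)_e.  As Z(N, h)_e is the spectrum of the quotient by   *)
(* this ideal, the algebra of its global sections is that quotient.           *)
Definition in_idealZ (h : hess_fun n) : pred A :=
  gen_ideal (fun p : 'I_n * 'I_n => (p.2 < n.-1)%N && (h p.2 < p.1)%N)
            (fun p => (invmx gen_unip *m jordan A n *m gen_unip) p.1 p.2).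

Definition eval0 : {rmorphism A -> C} := evalT (fun=> 0).

Lemma unip0 : unip (fun _ : xvar n => 0 : C) = 1%:M.
Proof.
apply/matrixP => i j; rewrite !mxE; case: insubP => // u /= lt_ji _.
by rewrite -val_eqE /= gtn_eqF.
Qed.

Lemma map_gen_unip (a : xvar n -> C) : map_mx (evalT a) gen_unip = unip a.
Proof.
apply/matrixP => i j; rewrite !mxE; case: insubP => [u _ _|_].
  by rewrite /evalT /varT mevalXU enum_rankK.
by rewrite rmorph_nat.
Qed.

Lemma eval0_gen_unip i j : eval0 (gen_unip i j) = (i == j)%:R.
Proof.
have /matrixP/(_ i j) := map_gen_unip (fun=> 0).
by rewrite unip0 mxE [RHS]mxE.
Qed.

Lemma map_jordan (B B' : pzRingType) (f : {rmorphism B -> B'}) :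
  map_mx f (jordan B n) = jordan B' n.
Proof. by apply/matrixP => i j; rewrite !mxE rmorph_nat. Qed.

Lemma gen_unip_unit : gen_unip \in unitmx.
Proof.
have trig : is_trig_mx gen_unip.
  apply/is_trig_mxP => i j lt_ij; rewrite mxE insubF; last first.
    by rewrite /= ltnNge ltnW.
  by rewrite -val_eqE /= ltn_eqF.
rewrite unitmxE det_trig // big1 ?unitr1 // => i _.
by rewrite mxE insubF ?eqxx //= ltnn.
Qed.

Lemma idealF_closed h m : idealr_closed (in_idealF h m).
Proof.
apply: (gen_ideal_closed (ev := eval0)) => -[i j] /= /andP[_ lt_hj_i].
have lt_ji := leq_ltn_trans (hess_ge h j) lt_hj_i.
rewrite -det_map_mx (expand_det_row _ i) big1 // => l _.
rewrite mxE [X in eval0 X]mxE; case: eqVneq => [_|ne_li].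
  rewrite mxE rmorph_sum big1 ?mul0r // => k _.
  rewrite rmorphM eval0_gen_unip mxE rmorph_nat -natrM mulnb.
  case: eqP => //= ek; case: eqP => // ekj; move: lt_ji.
  by rewrite -ekj ek ltnNge leqnSn.
by rewrite eval0_gen_unip eq_sym (negPf ne_li) mul0r.
Qed.

Lemma idealZ_closed h : idealr_closed (in_idealZ h).
Proof.
apply: (gen_ideal_closed (ev := eval0)) => -[i j] /= /andP[_ lt_hj_i].
have lt_ji := leq_ltn_trans (hess_ge h j) lt_hj_i.
have g1 : map_mx eval0 gen_unip = 1%:M by rewrite -unip0 -map_gen_unip.
have gV1 : map_mx eval0 (invmx gen_unip) = 1%:M.
  by rewrite -[LHS]mulmx1 -{1}g1 -map_mxM mulVmx ?gen_unip_unit ?map_mx1.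
have : map_mx eval0 (invmx gen_unip *m jordan A n *m gen_unip) = jordan C n.
  by rewrite !map_mxM g1 gV1 mul1mx mulmx1 map_jordan.
move=> /matrixP/(_ i j); rewrite mxE => ->; rewrite mxE.
by case: eqP => // ej; rewrite ej ltnNge leqnSn in lt_ji.
Qed.

HB.instance Definition _ h m := isIdealr.Build A (in_idealF h m)
  (idealF_closed h m).
HB.instance Definition _ h := isIdealr.Build A (in_idealZ h) (idealZ_closed h).

Definition idealF h m : idealr A := in_idealF h m.
Definition idealZ h : idealr A := in_idealZ h.

End LowerUnipotentCoordinates.

Section HessenbergVariety.
Variables (C : fieldType) (n : nat).

(* Full flags V_1 < ... < V_n in C^n (V_0 = 0 is omitted).                    *)
Record flag := Flag {
  flag_val :> 'I_n -> {vspace 'cV[C]_n};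
  flag_dim : forall j : 'I_n, \dim (flag_val j) = j.+1;
  flag_nested : forall i j : 'I_n, (i <= j)%N -> (flag_val i <= flag_val j)%VS
}.

Definition span_cols (b : 'M[C]_n) (j : 'I_n) : {vspace 'cV[C]_n} :=
  <<[seq col k b | k : 'I_n <- enum 'I_n & (k <= j)%N]>>%VS.

(* V = bB in GL_n / B.                                                        *)
Definition flag_of (b : 'M[C]_n) (V : flag) : Prop := V =1 span_cols b.

Definition Hess (h : hess_fun n) (V : flag) : Prop :=
  forall (i : 'I_n) (v : 'cV[C]_n), v \in V i -> jordan C n *m v \in V (h i).

(* The lower triangular invertible matrices act on eB by b |-> bB.            *)
Definition Omega_e (V : flag) : Prop :=
  exists b : 'M[C]_n, [/\ is_trig_mx b, b \in unitmx & flag_of b V].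

(* The vanishing ideal of Hess(N, h) in Omega_e, where Omega_e is identified  *)
(* with affine space through the coordinates x_{ij}; the quotient by it is    *)
(* the coordinate ring of the reduced affine variety.                         *)
Definition in_idealHess (h : hess_fun n) : pred {mpolyT C[xvar n]} :=
  fun f => `[< forall V : flag, Hess h V -> Omega_e V ->
               forall a : xvar n -> C, flag_of (unip a) V -> evalT a f = 0 >].

Lemma dim_span_cols (b : 'M[C]_n) (j : 'I_n) :
  b \in unitmx -> \dim (span_cols b j) = j.+1.
Proof.
move=> ub; pose X k := col k b; set p := fun k : 'I_n => (k <= j)%N.
have Xfull : <<map X (enum 'I_n)>>%VS = fullv.
  apply/eqP; rewrite eqEsubv subvf /=; apply/subvP => v _.
  have -> : v = \sum_k (invmx b *m v) k 0 *: X k.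
    rewrite -[LHS](mulKVmx ub); apply/matrixP => i z; rewrite !mxE summxE.
    by apply: eq_bigr => k _; rewrite !mxE mulrC (ord1 z).
  by apply: memv_suml => k _; apply/memvZ/memv_span/map_f; rewrite mem_enum.
have Xfree : free (map X (enum 'I_n)).
  by rewrite /free Xfull dimvf size_map size_enum_ord dim_matrix mulr1.
have {}Xfree : free (map X (filter p (enum 'I_n))).
  suff : free (map X (filter p (enum 'I_n)) ++
               map X (filter (predC p) (enum 'I_n))) by move/catl_free.
  by rewrite -map_cat (perm_free (perm_map X (permEl (perm_filterC _ _)))).
rewrite /span_cols (eqP Xfree) size_map -(size_map val).
rewrite -(filter_map val (fun k => k <= j)%N) val_enum_ord.
by rewrite (@filter_iota_leq n 0 j) ?size_iota.
Qed.

Lemma idealHess_closed h : idealr_closed (in_idealHess h).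
Proof.
have dim1 j : \dim (span_cols 1%:M j) = j.+1.
  by apply: dim_span_cols; rewrite unitmx1.
have nest1 (i j : 'I_n) : (i <= j)%N ->
    (span_cols 1%:M i <= span_cols 1%:M j)%VS.
  move=> le_ij; apply: sub_span => _ /mapP[k + ->].
  rewrite mem_filter => /andP[le_ki k_in]; apply: map_f.
  by rewrite mem_filter (leq_trans le_ki).
pose V1 := Flag dim1 nest1.
have HV1 : Hess h V1.
  move=> i v vV.
  pose f : 'Hom('cV[C]_n, 'cV[C]_n) := linfun (mulmx (jordan C n)).
  have -> : jordan C n *m v = f v by rewrite lfunE.
  apply: (subvP _ _ (memv_img f vV)); rewrite /= /span_cols limg_span.
  apply/span_subvP => _ /mapP[_ /mapP[k + ->] ->].
  rewrite mem_filter => /andP[le_ki _]; rewrite lfunE /=.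
  rewrite [col k 1%:M]colE mul1mx -colE.
  case: (posnP k) => [k0|k_gt0].
    rewrite [X in X \in _](_ : _ = 0) ?mem0v //.
    by apply/colP => l; rewrite !mxE k0.
  have lt_k1 : (k.-1 < n)%N by exact: leq_ltn_trans (leq_pred k) (ltn_ord k).
  rewrite [X in X \in _](_ : _ = col (Ordinal lt_k1) 1%:M).
    apply/memv_span/map_f; rewrite mem_filter mem_enum andbT /=.
    by rewrite (leq_trans (leq_pred _)) // (leq_trans le_ki) ?hess_ge.
  apply/colP => l; rewrite !mxE -val_eqE /= -{1}(prednK k_gt0) eqSS.
  by rewrite eq_sym.
have OV1 : Omega_e V1.
  by exists 1%:M; split; [exact: scalar_mx_is_trig | exact: unitmx1 | ].
split.
- by apply/asboolP => *; rewrite rmorph0.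
- apply/asboolP => I1; have V1E : flag_of (unip (fun=> 0)) V1.
    by move=> j; rewrite unip0.
  have /eqP := I1 V1 HV1 OV1 _ V1E.
  by rewrite rmorph1 oner_eq0.
- move=> c f g /asboolP If /asboolP Ig; apply/asboolP => V HV OV a aV.
  by rewrite rmorphD rmorphM /= (If V) // (Ig V) // mulr0 addr0.
Qed.

HB.instance Definition _ h :=
  isIdealr.Build {mpolyT C[xvar n]} (in_idealHess h) (idealHess_closed h).

Definition idealHess h : idealr {mpolyT C[xvar n]} := in_idealHess h.

End HessenbergVariety.

(* The pair (r, s) indexes the variable q_{rs}.                               *)
Definition qvar n : finType := {p : 'I_n * 'I_n | (p.1 < p.2)%N}.

(* rev_ord s stands for n + 1 - s.                                            *)
Definition hqvar n (h : hess_fun n) : finType :=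
  {p : 'I_n * 'I_n | (n - (h (rev_ord p.2)).+1 < p.1.+1)%N && (p.1 < p.2)%N}.

Definition xqvar n : finType := ('I_n + qvar n)%type.
Definition hxqvar n (h : hess_fun n) : finType := ('I_n + hqvar h)%type.

Section CharacteristicCoefficients.
Variables (C : fieldType) (n : nat).
Local Notation A := {mpolyT C[xqvar n]}.

Definition xq_x (k : 'I_n) : A := @varT C (xqvar n) (inl k).
Definition xq_q (t : qvar n) : A := @varT C (xqvar n) (inr t).

Definition M (s : nat) (le_sn : (s <= n)%N) : 'M[A]_s :=
  \matrix_(k, l)
    let k' := widen_ord le_sn k in let l' := widen_ord le_sn l in
    if k == l then xq_x k'
    else if k == l.+1 :> nat then -1
    else if (insub (k', l') : option (qvar n)) is Some t then xq_q t
    else 0.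

(* E_i^(s), read off the coefficient of lambda^(s - i); meaningful for i <= s *)
Definition E (s : nat) (le_sn : (s <= n)%N) (i : nat) : A :=
  (-1) ^+ i * (char_poly (M le_sn))`_(s - i).

Variable h : hess_fun n.
Local Notation B := {mpolyT C[hxqvar h]}.

(* The substitution q_{rs} = 0 for r <= n - h(n + 1 - s).                     *)
Definition kill (v : xqvar n) : B :=
  match v with
  | inl k => @varT C (hxqvar h) (inl k)
  | inr t => if (insub (val t) : option (hqvar h)) is Some u
             then @varT C (hxqvar h) (inr u) else 0
  end.

Definition hE (s : nat) (le_sn : (s <= n)%N) (i : nat) : B :=
  substT kill (E le_sn i).

Definition in_idealE : pred B :=
  gen_ideal xpredT (fun i : 'I_n => hE (leqnn n) i.+1).

Lemma idealE_closed : idealr_closed in_idealE.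
Proof.
pose ev0 : {rmorphism B -> C} := evalT (fun=> 0).
apply: (gen_ideal_closed (ev := ev0)) => i _.
have [psi psiE] : exists psi : {rmorphism A -> C},
    forall f, psi f = ev0 (substT kill f) by exists (ev0 \o substT kill).
rewrite /hE -psiE /E rmorphM.
have -> k : psi ((char_poly (M (leqnn n)))`_k)
          = (char_poly (map_mx psi (M (leqnn n))))`_k.
  by rewrite -map_char_poly coef_map.
have evX (v : hxqvar h) : ev0 (varT C v) = 0.
  by rewrite /ev0 /= /evalT /varT mevalXU.
have psiX v : psi (varT C v) = 0.
  rewrite psiE /substT /varT mmapX mmap1U enum_rankK.
  case: v => [k|t] /=; first exact: evX.
  by case: insubP => [u _ _|_]; rewrite ?evX ?rmorph0.
have psiq (o : option (qvar n)) : psi (if o is Some t then xq_q t else 0) = 0.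
  by case: o => [t|]; [exact: psiX | exact: rmorph0].
have -> : map_mx psi (M (leqnn n)) = \matrix_(k, l) - (k == l.+1 :> nat)%:R.
  apply/matrixP => k l; rewrite !mxE; case: eqVneq => [->|_].
    by rewrite psiX eqn_leq ltnn andbF oppr0.
  case: eqP => _; first by rewrite rmorphN1.
  by rewrite oppr0; exact: psiq.
rewrite char_poly_trig; last first.
  apply/is_trig_mxP => k l lt_kl; rewrite mxE.
  case: eqP => [ek|_]; last by rewrite oppr0.
  by rewrite ek ltnNge leqnSn in lt_kl.
under eq_bigr => k _ do rewrite mxE eqn_leq ltnn andbF oppr0 subr0.
rewrite prodr_const card_ord coefXn; case: eqP => [e|_]; last by rewrite mulr0.
have : (n - i.+1 < n)%N by rewrite ltn_subrL (leq_ltn_trans _ (ltn_ord i)).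
by rewrite e ltnn.
Qed.

HB.instance Definition _ := isIdealr.Build B in_idealE idealE_closed.

Definition idealE : idealr B := in_idealE.

End CharacteristicCoefficients.

Arguments idealF C {n} h m.
Arguments idealZ C {n} h.
Arguments idealHess C {n} h.
Arguments idealE C {n} h.
Arguments xij C {n i j} lt_ji.
Arguments hE C {n} h {s} le_sn i.

(* Main.v *)
Require Import Defs.
From HB Require Import structures.
From mathcomp Require Import all_boot all_order all_algebra.
From mathcomp Require Import boolp reals complex.
From mathcomp.multinomials Require Import ssrcomplements mpoly.
From mathcomp Require Import zify ring.

Set Implicit Arguments.
Unset Strict Implicit.
Unset Printing Implicit Defensive.

Import GRing.Theory.

Local Open Scope ring_scope.

(** Why the theorem holds. Reverse the order of rows and columns of M = M_n and
    change its sign: the result X is lower Hessenberg with ones just above the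
    diagonal, its diagonal holds the -x_s and its lower part the -q_rs. Let
    chi_s be the characteristic polynomial of the leading s x s block of M, and
    let g be the matrix whose columns are the coefficients of chi_(n-1), ...,
    chi_0, with alternating signs; its entry (i, j) is E_(i-j)^(n-j).
    Multiplication by lambda, written in the basis of the chi_s, is the identity
    N g = g X + (E_1, ..., E_n)^T e_1^T of [coef_mx_mul]. Hence N g = g X once the
    E_i are zero. Conversely, if N g' = g' X with g' lower unipotent, then g' and
    all the E_i are determined: g' = g and E_i = 0 ([coef_mx_uniq]). So
    x_ij |-> E_(i-j)^(n-j) has the inverse that reads the x_s and the q_rs off the
    entries of -(g^-1 N g), and the equations (g^-1 N g)_ij = 0 for i > h(j) are
    the equations q_rs = 0 of the substitution that defines hE. This is the first
    isomorphism ([subst_hE_idealZ], [idealE_surj]).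

    For the second one it remains to see that a polynomial f in the x_ij that
    vanishes at all points of Hess(N, h) in Omega_e lies in the ideal I generated
    by the F_ij, when h is indecomposable. Let D be the product of the lower left
    minors of the generic matrix.

    Where D is invertible, g = v b^-1 with b upper triangular and v lower
    unipotent up to the order of its rows. Then Y = v^-1 N v is strictly lower
    triangular with ones below the diagonal, it has the Hessenberg shape, and the
    rows of v are l, l Y, l Y^2, ... where l is the first one. Apart from the last
    entry 1 of l, the entries of l and the remaining entries of Y within the shape
    are arbitrary: they are free coordinates. In them the
    vanishing of f on the points of Hess(N, h) is a polynomial identity over an
    infinite field, so it also holds for the universal point over the
    localization of the quotient by I at D ([idealHess_sub_Z]).

    It follows that f is killed by a power of D modulo I, and one needs that D is
    not a zero divisor there. Through the first part this is a statement on
    C[x, q] modulo the equations e_1 X^n = 0 and some of the q_rs. The first have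
    leading terms x_k^k for a suitable weight in which the q_rs have weight 0, so
    a linear automorphism of C[x, q] turns all the ideals concerned into monomial
    ideals ([monic_idealP]). There every other q_rs is regular, and D is regular
    as soon as it is so after setting further q_rs equal to 0
    ([monic_ideal_nzd]). Since h is indecomposable, one may thus assume that X is
    tridiagonal. Then the corner entry x_n1 divides the product of the entries
    q_(s-1)s ([corner_dvd]), and each minor divides a power of this corner entry
    ([lead_minor_dvd]), so that all of them are regular. *)

(** * Characteristic polynomials of Hessenberg matrices *)

Section HessenbergCharPoly.
Variables (L : comNzRingType) (a : nat -> nat -> L) (n : nat).

Definition chi s : {poly L} := char_poly (\matrix_(i < s, j < s) a i j).

Hypothesis a_sub : forall k, (k.+1 < n)%N -> a k.+1 k = -1.
Hypothesis a_low : forall i j, (j.+1 < i < n)%N -> a i j = 0.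

Lemma chi0 : chi 0 = 1.
Proof. by rewrite /chi /char_poly det_mx00. Qed.

(** The last row of the adjugate of lambda - M is, up to sign, (chi_0, ..., chi_s):
    its first entry is a triangular minor with unit diagonal, and the columns of
    adj(lambda - M) (lambda - M) = chi_(s+1) then give the other entries one by one,
    by the same recursion for smaller s. The last column is the claim. *)
Lemma chi_rec s : (s < n)%N ->
  chi s.+1 = \sum_(k < s.+1) (-1) ^+ (s + k) * chi k
               * ('X *+ (k == s :> nat) - (a k s)%:P).
Proof.
elim/ltn_ind: s => s IHs lt_sn.
set B := char_poly_mx (\matrix_(i < s.+1, j < s.+1) a i j).
have BE i j : B i j = 'X *+ (i == j :> nat) - (a i j)%:P by rewrite !mxE.
have adjB j : \sum_k \adj B ord_max k * B k j = chi s.+1 *+ (s == j :> nat).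
  have /matrixP/(_ ord_max j) := mul_adj_mx B.
  by rewrite !mxE.
have adjE k (lt_ks : (k < s.+1)%N) :
    \adj B ord_max (Ordinal lt_ks) = (-1) ^+ (s + k) * chi k.
  elim/ltn_ind: k lt_ks => -[|k] IHk lt_ks.
    have -> : Ordinal lt_ks = ord0 by apply: val_inj.
    rewrite mxE /cofactor addn0 add0n chi0 mulr1.
    rewrite -det_tr det_trig; last first.
      apply/is_trig_mxP => i j lt_ij; rewrite 3!mxE BE lift_max.
      have lt_js := ltn_ord j; rewrite /= in lt_js.
      rewrite lift0 a_low ?subr0 ?gtn_eqF //; first exact: ltnW.
      by rewrite ltnS lt_ij; exact: leq_ltn_trans lt_js lt_sn.
    rewrite big1 ?mulr1 // => i _; rewrite 3!mxE BE lift_max lift0.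
    have lt_is := ltn_ord i; rewrite /= in lt_is.
    rewrite a_sub ?gtn_eqF // ?mulr0n ?sub0r ?rmorphN ?opprK //.
    exact: leq_ltn_trans lt_is lt_sn.
  have lt_ks' : (k < s.+1)%N by lia.
  have := adjB (Ordinal lt_ks'); rewrite /= [s == k]gtn_eqF 1?mulr0n; last by lia.
  rewrite (bigD1 (Ordinal lt_ks)) //= BE /= a_sub; last by lia.
  rewrite eqn_leq ltnn /= mulr0n sub0r rmorphN opprK mulr1.
  move/eqP; rewrite addr_eq0 => /eqP ->.
  rewrite (IHs k) ?mulr_sumr -?sumrN; try lia.
  rewrite (bigID (fun i : 'I__ => (i < k.+1)%N)) /= [X in _ + X]big1 ?addr0; last first.
    move=> i; rewrite -leqNgt -val_eqE /= => /andP[ne_ik le_ki].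
    rewrite BE /= a_low ?subr0; last by have := ltn_ord i; lia.
    by rewrite gtn_eqF ?mulr0n ?mulr0 ?oppr0.
  have le_ks : (k.+1 <= s.+1)%N by lia.
  rewrite [RHS](big_ord_widen _ (fun i => (-1) ^+ (s + k.+1)
      * ((-1) ^+ (k + i) * chi i * ('X *+ (i == k) - (a i k)%:P))) le_ks).
  apply: eq_big => [i|i /andP[_ lt_ik]].
    by rewrite -val_eqE /=; case: ltnP; rewrite ?andbF // andbT; lia.
  have -> : i = Ordinal (ltn_ord i) by apply: val_inj.
  have sgnE : (-1) ^+ (s + k.+1) * (-1) ^+ (k + i) = - (-1) ^+ (s + i) :> {poly L}.
    rewrite -exprD -[RHS]mulN1r -exprS -[LHS]signr_odd -[RHS]signr_odd.
    by congr (_ ^+ nat_of_bool _); lia.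
  by rewrite IHk // BE /= !mulrA sgnE !mulNr.
have := adjB ord_max; rewrite /= eqxx mulr1n => <-; apply: eq_bigr => k _.
have -> : k = Ordinal (ltn_ord k) by apply: val_inj.
by rewrite adjE BE.
Qed.

Lemma size_chi s : size (chi s) = s.+1. Proof. exact: size_char_poly. Qed.
Lemma chi_lead s : (chi s)`_s = 1.
Proof.
have /monicP := char_poly_monic (\matrix_(i < s, j < s) a i j).
by rewrite lead_coefE size_char_poly.
Qed.

End HessenbergCharPoly.

(** * The matrix of coefficients of the polynomials chi_s *)

Definition e0 (L : pzRingType) m : 'rV[L]_m.+1 := delta_mx 0 0.

Definition krylov (L : pzRingType) n (l : 'rV[L]_n) (X : 'M[L]_n) k : 'rV[L]_n :=
  iter k (fun r => r *m X) l.

Definition lower_unip (L : pzRingType) n (g : 'M[L]_n) : Prop :=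
  forall i j : 'I_n, (i <= j)%N -> g i j = (i == j)%:R.

Definition lower_hess (L : pzRingType) n (X : 'M[L]_n) : Prop :=
  forall i j : 'I_n, (i < j)%N -> X i j = (j == i.+1 :> nat)%:R.

Section Krylov.
Variables (L : comNzRingType) (m : nat).
Implicit Types (g X : 'M[L]_m.+1) (l : 'rV[L]_m.+1).
Local Notation N := (jordan L m.+1).

Lemma jordan_mulE (B : 'M[L]_m.+1) i j :
  (N *m B) i j = if insub i.+1 is Some k then B k j else 0.
Proof.
rewrite mxE; case: insubP => [k _ ek|].
  rewrite (bigD1 k) //= big1 => [|l ne_lk]; rewrite mxE.
    by rewrite ek eqxx mul1r addr0.
  by rewrite -ek val_eqE (negPf ne_lk) mul0r.
rewrite -leqNgt => le_mi; rewrite big1 // => l _; rewrite mxE.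
by rewrite ltn_eqF ?mul0r // (leq_trans (ltn_ord l)).
Qed.

Lemma row_jordan_mul (B : 'M[L]_m.+1) (i : 'I_m.+1) :
  row i (N *m B) = if insub i.+1 is Some k then row k B else 0.
Proof.
by apply/rowP => j; rewrite mxE jordan_mulE; case: insubP => [k _ _|_]; rewrite mxE.
Qed.

(** N shifts the rows of a matrix up by one, so N g = g X says that each row of g is
    X applied to the previous one, and that X kills the last. *)
Lemma row_krylov g X l : N *m g = g *m X -> row 0 g = l ->
  (forall i : 'I_m.+1, row i g = krylov l X i) /\ krylov l X m.+1 = 0.
Proof.
move=> NgE g0.
have stepE (i : 'I_m.+1) : row i g *m X
    = if insub i.+1 is Some k then row k g else 0.
  by rewrite -row_mul -NgE row_jordan_mul.
have rowE k (lt_km : (k < m.+1)%N) : row (Ordinal lt_km) g = krylov l X k.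
  elim: k lt_km => [|k IHk] lt_km /=.
    by rewrite -g0; congr (row _ g); apply: val_inj.
  rewrite -(IHk (ltnW lt_km)) stepE insubT /=.
  by congr (row _ g); apply: val_inj.
split=> [i|]; first by rewrite -rowE; congr (row _ g); apply: val_inj.
by rewrite /krylov iterS -/(krylov l X m) -(rowE m (ltnSn m)) stepE insubF //= ltnn.
Qed.

Lemma krylov_row g X l : (forall i : 'I_m.+1, row i g = krylov l X i) ->
  krylov l X m.+1 = 0 -> N *m g = g *m X.
Proof.
move=> gE l0; apply/row_matrixP => i; rewrite row_jordan_mul row_mul gE.
case: insubP => [k _ ek|]; first by rewrite gE ek.
by rewrite -leqNgt ltnS => le_mi; rewrite (_ : i = m :> nat) -?l0 //;
   apply/eqP; rewrite eqn_leq le_mi -ltnS ltn_ord.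
Qed.

(** X moves the support of a row by at most one place to the right, with
    coefficient 1 in the new place. *)
Lemma krylov_hess X k (j : 'I_m.+1) : lower_hess X -> (k <= j)%N ->
  krylov (e0 L m) X k 0 j = (k == j)%:R.
Proof.
move=> hX; elim: k j => [|k IHk] j le_kj.
  by rewrite /krylov /= mxE -!val_eqE /= eq_sym.
rewrite /= mxE -/(krylov _ _ k).
have lt_km : (k < m.+1)%N by apply: leq_ltn_trans (ltn_ord j); exact: ltnW.
rewrite (bigD1 (Ordinal lt_km)) //= big1 => [|i ne_ik].
  by rewrite IHk //= eqxx mul1r addr0 hX //= eq_sym.
case: (ltnP k i) => [lt_ki|le_ik].
  by rewrite IHk 1?ltnW // ltn_eqF ?mul0r.
have lt_ik : (i < k)%N by rewrite ltn_neqAle le_ik andbT -(inj_eq val_inj) in ne_ik *.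
rewrite hX; last exact: ltn_trans lt_ik le_kj.
by rewrite [_ == _]gtn_eqF ?mulr0 //; exact: leq_trans le_kj.
Qed.

End Krylov.

Section CoefficientMatrix.
Variables (L : comNzRingType) (a : nat -> nat -> L) (m : nat).
Hypothesis a_sub : forall k, (k.+1 < m.+1)%N -> a k.+1 k = -1.
Hypothesis a_low : forall i j, (j.+1 < i < m.+1)%N -> a i j = 0.
Local Notation N := (jordan L m.+1).

(** Column j holds the coefficients of chi_(n-1-j), from the highest power of lambda
    down; the sign turns them into the elementary-symmetric normalization, so that
    below the diagonal the entry (i, j) is E_(i-j)^(n-1-j). *)
Definition coef_mx : 'M[L]_m.+1 :=
  \matrix_(i, j) ((-1) ^+ (i + j) * (chi a (m - j))`_(m - i)).

Definition rev_mx : 'M[L]_m.+1 := \matrix_(i, j) - a (m - i) (m - j).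

(** This is E_(i+1)^(n). *)
Definition eps (i : nat) : L := (-1) ^+ i.+1 * (chi a m.+1)`_(m - i).

Lemma coef_mx_unip : lower_unip coef_mx.
Proof.
move=> i j le_ij; rewrite mxE; case: eqVneq => [->|ne_ij].
  by rewrite chi_lead mulr1 -signr_odd oddD addbb.
rewrite nth_default ?mulr0 // size_chi.
have /negPf := ne_ij; rewrite -val_eqE /= => {ne_ij}.
by have := ltn_ord j; lia.
Qed.

Lemma rev_mx_hess : lower_hess rev_mx.
Proof.
move=> i j lt_ij; rewrite mxE; have lt_jm := ltn_ord j.
case: eqP => [ej|ne_j].
  by rewrite (_ : (m - i = (m - j).+1)%N) ?a_sub ?opprK //; lia.
by rewrite a_low ?oppr0 //; lia.
Qed.

(** Column j is the recursion for lambda chi_(n-1-j). The polynomial chi_n, which is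
    not among the columns of [coef_mx], only enters for j = 0. *)
Lemma coef_mx_mul (i j : 'I_m.+1) : (N *m coef_mx) i j
  = (coef_mx *m rev_mx) i j + eps i *+ (j == ord0).
Proof.
have lt_im := ltn_ord i; have lt_jm := ltn_ord j.
set s := (m - j)%N.
have lt_sm : (s < m.+1)%N by rewrite ltnS leq_subr.
have NE : (N *m coef_mx) i j
    = - ((-1) ^+ (i + j) * (chi a s * 'X)`_(m - i)).
  rewrite jordan_mulE coefMX; case: insubP => [k _ ek|].
    rewrite !mxE ek subn_eq0 leqNgt.
    have -> /= : (i < m)%N by rewrite -ltnS -ek ltn_ord.
    by rewrite addSn exprS mulN1r mulNr -subnS.
  by rewrite -leqNgt ltnS -subn_eq0 => ->; rewrite mulr0 oppr0.
have chiE := chi_rec a_sub a_low lt_sm.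
have sgnE : (-1) ^+ (i + j) * (-1) ^+ (s + m) = (-1) ^+ i :> L.
  by rewrite -exprD -signr_odd -[RHS]signr_odd; congr (_ ^+ nat_of_bool _); lia.
have chiE' : (chi a s * 'X)`_(m - i) = (chi a s.+1)`_(m - i)
    + \sum_(k < s.+1) (-1) ^+ (s + k) * (chi a k)`_(m - i) * a k s.
  rewrite chiE big_ord_recr /= eqxx mulr1n addnn -signr_odd odd_double mul1r.
  rewrite big_ord_recr /= addnn -[(-1) ^+ s.*2]signr_odd odd_double mul1r.
  rewrite mulrBr coefD coefB coef_sum coefMC.
  under [X in _ = X + _ + _]eq_bigr => k _.
    rewrite (ltn_eqF (ltn_ord k)) mulr0n sub0r mulrN coefN coefMC.
    rewrite -[(-1) ^+ _]signr_odd -(rmorph_sign (polyC)) coefCM signr_odd.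
    over.
  by rewrite sumrN; ring.
rewrite NE chiE' [X in _ = X + _]mxE.
rewrite [X in _ = X + _](reindex_inj rev_ord_inj) /=.
under [X in _ = X + _]eq_bigr => k _.
  rewrite !mxE /= ?subSS -/s subKn; last by rewrite -ltnS ltn_ord.
  over.
rewrite /= -(big_mkord xpredT
  (fun k => (-1) ^+ (i + (m - k)) * (chi a k)`_(m - i) * - a k s)).
rewrite (big_cat_nat (n := s.+1)) //=.
have tailE : \sum_(s.+1 <= k < m.+1) (-1) ^+ (i + (m - k)) * (chi a k)`_(m - i) * - a k s
   = - ((-1) ^+ (i + j) * (chi a s.+1)`_(m - i)) *+ (j != ord0).
  case: eqVneq => [j0|nz_j].
    by rewrite big_geq // /s j0 subn0.
  have j_gt0 : (0 < j)%N by rewrite lt0n -val_eqE /= in nz_j *.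
  rewrite big_ltn; last by rewrite /s; lia.
  rewrite big_nat big1 ?addr0 => [|k lt_k]; last by rewrite a_low ?oppr0 ?mulr0 //; lia.
  rewrite a_sub; last by rewrite /s; lia.
  rewrite opprK mulr1 mulr1n -mulNr; congr (_ * _).
  rewrite -[RHS]mulN1r -exprS -[LHS]signr_odd -[RHS]signr_odd.
  by congr (_ ^+ nat_of_bool _); rewrite /s; lia.
rewrite tailE big_mkord.
have sumE : \sum_(k < s.+1) (-1) ^+ (i + (m - k)) * (chi a k)`_(m - i) * - a k s
   = - ((-1) ^+ (i + j) * \sum_(k < s.+1) (-1) ^+ (s + k) * (chi a k)`_(m - i) * a k s).
  rewrite mulr_sumr -sumrN; apply: eq_bigr => k _; rewrite mulrN !mulrA.
  congr (- (_ * _ * _)); rewrite -exprD -signr_odd -[RHS]signr_odd.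
  by congr (_ ^+ nat_of_bool _); have := ltn_ord k; rewrite /s; lia.
rewrite sumE /eps mulrDr opprD [LHS]addrC -[RHS]addrA; congr (_ + _).
case: eqVneq => [j0|_] /=; last by rewrite mulr1n mulr0n addr0.
rewrite j0 mulr0n add0r mulr1n addn0 /s j0 subn0 exprS mulN1r mulNr //.
Qed.

Local Notation kry := (krylov (e0 L m) rev_mx).

(** Iterating [coef_mx_mul] along the rows: each row of [coef_mx] is e_0 X^i plus the
    contributions of the previous E_l, and the row after the last one is zero. *)
Lemma krylov_eps : kry m.+1 = - \sum_(l < m.+1) eps l *: kry (m - l).
Proof.
pose rho i := if insub i is Some k then row (k : 'I_m.+1) coef_mx else 0.
have rhoS (i : 'I_m.+1) : rho i.+1 = row i coef_mx *m rev_mx + eps i *: e0 L m.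
  rewrite /rho -row_jordan_mul -row_mul; apply/rowP => j.
  by rewrite mxE coef_mx_mul !mxE eqxx /= mulr_natr.
have rhoE i : (i <= m.+1)%N ->
    rho i = kry i + \sum_(l < i) eps l *: kry (i.-1 - l).
  elim: i => [_|i IHi lt_im].
    rewrite big_ord0 addr0 /rho insubT /=; apply/rowP => j.
    by rewrite [LHS]mxE coef_mx_unip // mxE eqxx eq_sym.
  rewrite (rhoS (Ordinal lt_im)) /=.
  have -> : row (Ordinal lt_im) coef_mx = rho i.
    by rewrite /rho insubT.
  rewrite IHi 1?ltnW // mulmxDl big_ord_recr /= subnn addrA; congr (_ + _ + _).
  rewrite mulmx_suml; apply: eq_bigr => l _; rewrite -scalemxAl; congr (_ *: _).
  by rewrite -[LHS]/(kry _.+1); congr (kry _); have := ltn_ord l; lia.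
have := rhoE m.+1 (leqnn _); rewrite /rho insubF ?ltnn // => /esym/eqP.
by rewrite addr_eq0 => /eqP.
Qed.

(** The system of [krylov_eps] is unitriangular in the E_l, because e_0 X^k ends with
    a 1 in place k. *)
Lemma eps_eq0 : kry m.+1 = 0 -> forall i, (i <= m)%N -> eps i = 0.
Proof.
move=> kry0; elim/ltn_ind => i IHi le_im.
have := krylov_eps; rewrite kry0 => /esym/eqP; rewrite oppr_eq0 => /eqP.
have lt_mi : (m - i < m.+1)%N by rewrite ltnS leq_subr.
move/rowP/(_ (Ordinal lt_mi)); rewrite summxE mxE.
have lt_im : (i < m.+1)%N by [].
rewrite (bigD1 (Ordinal lt_im)) //= big1 ?addr0 => [|l ne_li].
  by rewrite mxE krylov_hess //= ?eqxx ?mulr1 //; exact: rev_mx_hess.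
rewrite mxE; case: (ltnP l i) => [lt_li|le_il].
  by rewrite IHi ?mul0r // (leq_trans (ltnW lt_li)).
have := ltn_ord l; rewrite -(inj_eq val_inj) /= in ne_li => lt_lm.
rewrite krylov_hess ?leq_sub2l //; last exact: rev_mx_hess.
by rewrite [_ == _]ltn_eqF ?mulr0 //=; lia.
Qed.

Lemma coef_mx_commute : (forall i, (i <= m)%N -> eps i = 0) ->
  N *m coef_mx = coef_mx *m rev_mx.
Proof.
move=> e0; apply/matrixP => i j.
by rewrite coef_mx_mul e0 ?mul0rn ?addr0 // -ltnS.
Qed.

Lemma coef_mx_uniq g : lower_unip g -> N *m g = g *m rev_mx ->
  coef_mx = g /\ (forall i, (i <= m)%N -> eps i = 0).
Proof.
have row0 g' : lower_unip g' -> row 0 g' = e0 L m.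
  move=> ug; apply/rowP => j; rewrite [LHS]mxE ug // mxE eqxx eq_sym.
  by rewrite -!val_eqE.
move=> ug NgE; have [gE kry0] := row_krylov NgE (row0 _ ug).
have eps0 := eps_eq0 kry0; split=> //; apply/row_matrixP => i.
have [-> _] := row_krylov (coef_mx_commute eps0) (row0 _ coef_mx_unip).
by rewrite gE.
Qed.

End CoefficientMatrix.

Section MapMx.
Variables (L L' : comNzRingType) (s : {rmorphism L -> L'}).

Lemma map_coef_mx (a : nat -> nat -> L) m :
  map_mx s (coef_mx a m) = coef_mx (fun i j => s (a i j)) m.
Proof.
apply/matrixP => i j; rewrite !mxE rmorphM rmorph_sign -coef_map map_char_poly.
by congr (_ * _`_ _); congr char_poly; apply/matrixP => k l; rewrite !mxE.
Qed.

Lemma map_rev_mx (a : nat -> nat -> L) m :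
  map_mx s (rev_mx a m) = rev_mx (fun i j => s (a i j)) m.
Proof. by apply/matrixP => i j; rewrite !mxE rmorphN. Qed.

Lemma map_krylov n (l : 'rV[L]_n) (X : 'M[L]_n) k :
  map_mx s (krylov l X k) = krylov (map_mx s l) (map_mx s X) k.
Proof.
elim: k => [//|k IHk].
by rewrite /krylov !iterS -!/(krylov _ _ k) map_mxM IHk.
Qed.

Lemma map_e0 m : map_mx s (e0 L m) = e0 L' m.
Proof. exact: map_delta_mx. Qed.
End MapMx.

(** * Ideals, quotients and substitutions *)

Section Quotients.
Variables (K : comNzRingType) (A : comAlgType K).

Lemma proj_eq0 (I : idealr A) f : (proj I f == 0) = (f \in I).
Proof. by rewrite -[f in RHS]subr0 Quotient.idealrBE -!/(proj I _) rmorph0. Qed.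

Lemma proj_surj (I : idealr A) (x : {ideal_quot I}) : exists f, x = proj I f.
Proof. by exists (repr x); rewrite /proj reprK. Qed.

Section Lift.
Variables (I : idealr A) (Q : comAlgType K) (phi : {lrmorphism A -> Q}).
Hypothesis phiI : forall f, f \in I -> phi f = 0.

Definition quot_lift (x : {ideal_quot I}) : Q := phi (repr x).

Fact quot_liftE f : quot_lift (proj I f) = phi f.
Proof.
have /phiI/eqP : repr (proj I f) - f \in I.
  by rewrite -proj_eq0 rmorphB /= [X in X - _]reprK subrr.
by rewrite rmorphB subr_eq0 => /eqP.
Qed.

Fact quot_lift_zmod : zmod_morphism quot_lift.
Proof.
move=> x y; have [f ->] := proj_surj x; have [g ->] := proj_surj y.
by rewrite -rmorphB /= !quot_liftE rmorphB.
Qed.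
Fact quot_lift_monoid : monoid_morphism quot_lift.
Proof.
split=> [|x y]; first by rewrite -(rmorph1 (proj I)) quot_liftE rmorph1.
have [f ->] := proj_surj x; have [g ->] := proj_surj y.
by rewrite -rmorphM /= !quot_liftE rmorphM.
Qed.
Fact quot_lift_scalable : scalable quot_lift.
Proof.
move=> k x; have [f ->] := proj_surj x.
by rewrite -linearZ /= !quot_liftE linearZ.
Qed.
HB.instance Definition _ :=
  GRing.isZmodMorphism.Build {ideal_quot I} Q quot_lift quot_lift_zmod.
HB.instance Definition _ :=
  GRing.isMonoidMorphism.Build {ideal_quot I} Q quot_lift quot_lift_monoid.
HB.instance Definition _ :=
  GRing.isScalable.Build K {ideal_quot I} Q *:%R quot_lift quot_lift_scalable.

Definition quot_lrmorphism : {lrmorphism {ideal_quot I} -> Q} := quot_lift.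
End Lift.

End Quotients.

Lemma quot_iso (K : comNzRingType) (A B : comAlgType K) (I : idealr A)
    (J : idealr B) (phi : {lrmorphism A -> B}) :
  (forall f, (f \in I) = (phi f \in J)) ->
  (forall b, exists f, proj J b = proj J (phi f)) ->
  exists Phi : {lrmorphism {ideal_quot I} -> {ideal_quot J}},
    bijective Phi /\ forall f, Phi (proj I f) = proj J (phi f).
Proof.
move=> memI surj.
pose p : {lrmorphism A -> {ideal_quot J}} := proj J \o phi.
have pI f : f \in I -> p f = 0.
  by rewrite memI -proj_eq0 => /eqP.
have PhiE f : quot_lrmorphism pI (proj I f) = proj J (phi f).
  exact: quot_liftE.
have Phi_inj : injective (quot_lrmorphism pI).
  move=> x y; have [f ->] := proj_surj x; have [g ->] := proj_surj y.
  move/eqP; rewrite !PhiE -subr_eq0 -!rmorphB /= proj_eq0 -memI -proj_eq0.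
  by rewrite rmorphB subr_eq0 => /eqP.
have Phi_surj y : exists x, quot_lrmorphism pI x == y.
  have [b ->] := proj_surj y; have [f ->] := surj b.
  by exists (proj I f); rewrite PhiE.
exists (quot_lrmorphism pI); split; last exact: PhiE.
exists (fun y => xchoose (Phi_surj y)) => [x|y].
  by apply: Phi_inj; apply/eqP; exact: (xchooseP (Phi_surj _)).
by apply/eqP; exact: (xchooseP (Phi_surj y)).
Qed.

Section GenIdeal.
Variables (A : comNzRingType) (T : finType) (P : pred T) (F : T -> A).

Lemma gen_ideal_gen t : P t -> F t \in gen_ideal P F.
Proof.
move=> Pt; apply/asboolP; exists (fun t' => (t' == t)%:R).
rewrite (bigD1 t) //= eqxx mul1r big1 ?addr0 // => t' /andP[_ /negPf->].
by rewrite mul0r.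
Qed.

Lemma gen_ideal_lin x f g :
  f \in gen_ideal P F -> g \in gen_ideal P F -> x * f + g \in gen_ideal P F.
Proof.
move=> /asboolP[c ->] /asboolP[c' ->]; apply/asboolP.
exists (fun t => x * c t + c' t); rewrite mulr_sumr -big_split.
by apply: eq_bigr => t _; rewrite mulrDl mulrA.
Qed.

Lemma gen_ideal_hom (L : comNzRingType) (ev : {rmorphism A -> L}) :
  (forall t, P t -> ev (F t) = 0) -> forall f, f \in gen_ideal P F -> ev f = 0.
Proof.
move=> evF f /asboolP[c ->]; rewrite rmorph_sum big1 // => t Pt.
by rewrite rmorphM evF ?mulr0.
Qed.
End GenIdeal.

Lemma eq_gen_ideal (A : comNzRingType) (T : finType) (P P' : pred T)
    (F F' : T -> A) : P =1 P' -> (forall t, P t -> F t = F' t) ->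
  gen_ideal P F =1 gen_ideal P' F'.
Proof.
move=> eqP eqF f; apply/asboolP/asboolP => -[c ->]; exists c.
  by apply: eq_big => // t Pt; rewrite eqF.
by apply: eq_big => // t; rewrite -eqP => Pt; rewrite eqF.
Qed.

Lemma mpoly_hom_ext (K L : comNzRingType) n
    (s t : {rmorphism {mpoly K[n]} -> L}) :
    (forall c, s c%:MP = t c%:MP) -> (forall i, s 'X_i = t 'X_i) -> s =1 t.
Proof.
move=> stC stX p; rewrite [p]mpolyE !rmorph_sum; apply: eq_bigr => m _.
rewrite -mul_mpolyC !rmorphM stC mpolyXE_id !rmorph_prod /=; congr (_ * _).
by apply: eq_bigr => i _; rewrite !rmorphXn /= stX.
Qed.

Section SubstT.
Variables (K : comNzRingType) (T U : finType) (s : T -> {mpolyT K[U]}).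

Lemma substT_var t : substT s (varT K t) = s t.
Proof. by rewrite /substT /varT mmapX mmap1U enum_rankK. Qed.

Lemma substT_C c : substT s c%:MP = c%:MP.
Proof. exact: mmapC. Qed.

Fact substT_scalable : scalable (substT s).
Proof. by move=> k p; rewrite -!mul_mpolyC rmorphM /= substT_C. Qed.
HB.instance Definition _ :=
  GRing.isScalable.Build K _ _ *:%R (substT s) substT_scalable.
Definition substTL : {lrmorphism {mpolyT K[T]} -> {mpolyT K[U]}} := substT s.
End SubstT.

Lemma varT_hom_ext (K L : comNzRingType) (T : finType)
    (s t : {rmorphism {mpolyT K[T]} -> L}) :
    (forall c, s c%:MP = t c%:MP) -> (forall v, s (varT K v) = t (varT K v)) ->
  s =1 t.
Proof.
move=> stC stX; apply: mpoly_hom_ext => // i.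
by rewrite -(enum_valK i); exact: stX.
Qed.

(** * The generic unipotent matrix and the generic Hessenberg matrix *)

Section LowerUnip.
Variables (L : comNzRingType) (n : nat).
Implicit Types (g X : 'M[L]_n).

Lemma lower_unip_trig g : lower_unip g -> is_trig_mx g.
Proof.
move=> ug; apply/is_trig_mxP => i j lt_ij.
by rewrite ug 1?ltnW // -val_eqE /= ltn_eqF.
Qed.

Lemma det_lower_unip g : lower_unip g -> \det g = 1.
Proof.
move=> ug; rewrite det_trig ?lower_unip_trig // big1 // => i _.
by rewrite ug // eqxx.
Qed.

Lemma lower_unip_adj g : lower_unip g -> \adj g *m g = 1%:M.
Proof. by move=> ug; rewrite mul_adj_mx det_lower_unip. Qed.

Lemma lower_unip_inj g p : lower_unip g -> injective (mulmx g : 'M_(n, p) -> 'M_(n, p)).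
Proof.
move=> ug X Y /(congr1 (mulmx (\adj g))).
by rewrite !mulmxA lower_unip_adj // !mul1mx.
Qed.

(** Row i of N g = g X expresses row i of X through rows i + 1 and less of g and the
    previous rows of X. *)
Lemma lower_hess_conj g X : lower_unip g -> jordan L n *m g = g *m X ->
  lower_hess X.
Proof.
move=> ug NgE [i lt_in]; elim/ltn_ind: i lt_in => i IHi lt_in j lt_ij.
have /matrixP/(_ (Ordinal lt_in) j) := NgE.
have -> : (g *m X) (Ordinal lt_in) j = X (Ordinal lt_in) j.
  rewrite mxE (bigD1 (Ordinal lt_in)) //= ug // eqxx mul1r big1 ?addr0 // => k.
  case: (ltngtP k i) => [lt_ki _|lt_ik ne_ki|ek]; last 2 first.
  - by rewrite ug ?mul0r 1?ltnW // eq_sym (negPf ne_ki) mul0r.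
  - by rewrite -(inj_eq val_inj) /= ek eqxx.
  have -> : k = Ordinal (ltn_ord k) by apply: val_inj.
  rewrite IHi //=; last exact: ltn_trans lt_ij.
  by rewrite gtn_eqF ?mulr0 //; exact: leq_ltn_trans lt_ij.
move=> <-; rewrite mxE.
have lt_i1n : (i.+1 < n)%N by exact: leq_ltn_trans (ltn_ord j).
rewrite (bigD1 (Ordinal lt_i1n)) //= mxE eqxx mul1r ug // big1 ?addr0 => [|k ne_k].
  by rewrite -val_eqE /= eq_sym.
by rewrite mxE; rewrite -val_eqE /= in ne_k; rewrite (negPf ne_k) mul0r.
Qed.
End LowerUnip.

Section GenericHessenberg.
Variables (C : fieldType) (m : nat).
Local Notation n := m.+1.
Local Notation A := {mpolyT C[xqvar n]}.
Local Notation gU := (gen_unip C n).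

Definition M_entry (i j : nat) : A := M C (leqnn n) (inord i) (inord j).

Lemma M_block s (le_sn : (s <= n)%N) : M C le_sn = \matrix_(i < s, j < s) M_entry i j.
Proof.
apply/matrixP => i j; rewrite !mxE /M_entry mxE.
have E (k : 'I_s) : widen_ord (leqnn n) (inord k) = widen_ord le_sn k.
  by apply: val_inj; rewrite /= inordK // (leq_trans (ltn_ord k)).
rewrite !E -!(inj_eq val_inj) /= !inordK ?(leq_trans (ltn_ord _)) //.
Qed.

Variables (L : comNzRingType) (s : {rmorphism A -> L}).
Local Notation a := (fun i j => s (M_entry i j)).

Lemma M_entry_sub k : (k.+1 < n)%N -> a k.+1 k = -1.
Proof.
move=> lt_kn; have lt_kn' := ltnW lt_kn.
rewrite /M_entry mxE -!(inj_eq val_inj) /= !inordK //.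
by rewrite gtn_eqF // eqxx rmorphN1.
Qed.

Lemma M_entry_low i j : (j.+1 < i < n)%N -> a i j = 0.
Proof.
move=> /andP[lt_ji lt_in]; rewrite /M_entry mxE -!(inj_eq val_inj) /=.
have lt_jn : (j < n)%N by lia.
rewrite !inordK // !gtn_eqF ?insubF ?rmorph0 //= ?inordK //; lia.
Qed.

Lemma hom_E k (le_kn : (k <= n)%N) i :
  s (E C le_kn i) = (-1) ^+ i * (chi a k)`_(k - i).
Proof.
rewrite /E rmorphM rmorph_sign M_block -coef_map map_char_poly; congr (_ * _`_ _).
by congr char_poly; apply/matrixP => x y; rewrite !mxE.
Qed.

Lemma coef_mx_E (i j : 'I_n) : (j < i)%N ->
  coef_mx a m i j = s (E C (leq_subr j.+1 n) (i - j)).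
Proof.
move=> lt_ji; have lt_im := ltn_ord i; rewrite hom_E mxE; congr (_ * _`_ _); last lia.
rewrite -signr_odd -[RHS]signr_odd; congr (_ ^+ nat_of_bool _); lia.
Qed.

Lemma eps_E i : eps a m i = s (E C (leqnn n) i.+1).
Proof. by rewrite hom_E subSS. Qed.

(** The values of the variables x_s and q_rs for which X is the reversed opposite of M. *)
Definition xq_value (X : 'M[L]_n) (v : xqvar n) : L :=
  match v with
  | inl k => - X (rev_ord k) (rev_ord k)
  | inr t => - X (rev_ord (val t).1) (rev_ord (val t).2)
  end.

Lemma rev_mx_xq v : s (varT C v) = xq_value (rev_mx a m) v.
Proof.
have E (k : 'I_n) : inord (m - rev_ord k) = k.
  by rewrite /= subSS subKn ?inord_val // -ltnS ltn_ord.
have E' (k : 'I_n) : widen_ord (leqnn n) k = k by apply: val_inj.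
case: v => [k|t]; rewrite /xq_value mxE opprK /M_entry !E mxE !E'; first by rewrite eqxx.
have lt_t := valP t; rewrite -(inj_eq val_inj) /= ltn_eqF // ltn_eqF 1?ltnW //.
case: insubP => [u _ eu|/negP[] //].
by congr (s (varT C (inr _))); apply: val_inj; rewrite eu -surjective_pairing.
Qed.

End GenericHessenberg.

Lemma xq_value_inj (L : comNzRingType) m (X Y : 'M[L]_m.+1) :
  lower_hess X -> lower_hess Y -> xq_value X =1 xq_value Y -> X = Y.
Proof.
move=> hX hY eqXY; apply/matrixP => i j.
case: (ltngtP i j) => [lt_ij|lt_ji|/val_inj->].
- by rewrite hX // hY.
- have lt_rev : (rev_ord i < rev_ord j)%N by rewrite /=; have := ltn_ord i; lia.
  have := eqXY (inr (exist _ (rev_ord i, rev_ord j) lt_rev)).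
  by rewrite /xq_value /= !rev_ordK => /oppr_inj.
by have := eqXY (inl (rev_ord j)); rewrite /= !rev_ordK => /oppr_inj.
Qed.


Section GenericUnip.
Variables (C : fieldType) (m : nat).
Local Notation n := m.+1.
Local Notation gU := (gen_unip C n).

Lemma gen_unip_lower : lower_unip gU.
Proof.
by move=> i j le_ij; rewrite mxE insubF //= ltnNge le_ij.
Qed.

Lemma gen_unip_xij (i j : 'I_n) (lt_ji : (j < i)%N) : gU i j = xij C lt_ji.
Proof. by rewrite mxE insubT. Qed.

Definition conj_jordan := invmx gU *m jordan _ n *m gU.

Lemma gen_unip_conj_jordan : jordan _ n *m gU = gU *m conj_jordan.
Proof. by rewrite /conj_jordan -mulmxA mulKVmx ?gen_unip_unit. Qed.

(** Cramer's rule, as det g = 1. *)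
Lemma F_conj_jordan i j : F C i j = conj_jordan i j.
Proof.
have detg := det_lower_unip gen_unip_lower.
have -> : conj_jordan = \adj gU *m (jordan _ n *m gU).
  by rewrite /conj_jordan /invmx gen_unip_unit detg invr1 scale1r mulmxA.
rewrite /F (expand_det_col _ i) mxE; apply: eq_bigr => k _.
rewrite mxE eqxx mulrC; congr (_ * _).
rewrite mxE /cofactor; congr (_ * \det _); apply/matrixP => x y.
by rewrite !mxE eq_sym (negPf (neq_lift _ _)).
Qed.

Lemma hom_conj_jordan (L : comNzRingType) (t : {rmorphism {mpolyT C[xvar n]} -> L})
    (X : 'M[L]_n) :
  jordan L n *m map_mx t gU = map_mx t gU *m X -> map_mx t conj_jordan = X.
Proof.
have ug : lower_unip (map_mx t gU).
  by move=> i j le_ij; rewrite mxE gen_unip_lower // rmorph_nat.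
move=> tE; apply: (lower_unip_inj ug).
by rewrite -map_mxM -gen_unip_conj_jordan map_mxM map_jordan.
Qed.

Lemma conj_jordan_hess : lower_hess conj_jordan.
Proof. exact: lower_hess_conj gen_unip_lower gen_unip_conj_jordan. Qed.

End GenericUnip.

(** * The first isomorphism *)

Lemma quot_id (K : comNzRingType) (A : comAlgType K) (I J : idealr A) :
  I =i J -> exists Phi : {lrmorphism {ideal_quot I} -> {ideal_quot J}},
    bijective Phi /\ forall f, Phi (proj I f) = proj J f.
Proof. by move=> eqIJ; apply: (quot_iso (phi := idfun)) => // b; exists b. Qed.

Section Ideals.
Variables (C : fieldType) (m : nat) (h : hess_fun m.+1).
Local Notation n := m.+1.

Lemma hess_last (i j : 'I_n) : (h j < i)%N -> (j < n.-1)%N.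
Proof.
move=> lt_hji; have := hess_ge h j; have := ltn_ord i.
by rewrite /=; lia.
Qed.

Lemma hess_last2 (i j : 'I_n) : indecomposable h -> (h j < i)%N -> (j < n.-2)%N.
Proof.
move=> indec lt_hji; have := ltn_ord i; have := indec j (hess_last lt_hji).
by rewrite /=; lia.
Qed.

Definition off_hess (p : 'I_n * 'I_n) := (h p.2 < p.1)%N.

Lemma idealZE : idealZ C h =i gen_ideal off_hess (fun p => conj_jordan C m p.1 p.2).
Proof.
by apply: eq_gen_ideal => // p; apply: andb_idl => /hess_last.
Qed.

Lemma idealF_idealZ : idealF C h n.-1 =i idealZ C h.
Proof.
move=> f; rewrite idealZE; apply: eq_gen_ideal => p; last by rewrite F_conj_jordan.
by apply: andb_idl => /hess_last.
Qed.

Lemma idealF2_idealZ : indecomposable h -> idealF C h n.-2 =i idealZ C h.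
Proof.
move=> indec f; rewrite idealZE; apply: eq_gen_ideal => p; last by rewrite F_conj_jordan.
by apply: andb_idl => /(hess_last2 indec).
Qed.

Definition hE_subst (v : xvar n) : {mpolyT C[hxqvar h]} :=
  hE C h (leq_subr (val v).2.+1 n) ((val v).1 - (val v).2).

Definition killed (p : 'I_n * 'I_n) := (h (rev_ord p.2) < rev_ord p.1)%N.

Lemma not_killed (p : 'I_n * 'I_n) : (p.1 < p.2)%N ->
  ((n - (h (rev_ord p.2)).+1 < p.1.+1)%N && (p.1 < p.2)%N) = ~~ killed p.
Proof.
move=> lt_p; rewrite lt_p andbT /killed -leqNgt /=.
by have := ltn_ord p.1; have := ltn_ord (h (rev_ord p.2)); lia.
Qed.

Definition hxq_value (L : comNzRingType) (X : 'M[L]_n) (v : hxqvar h) : L :=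
  match v with
  | inl k => - X (rev_ord k) (rev_ord k)
  | inr t => - X (rev_ord (val t).1) (rev_ord (val t).2)
  end.

(** Both ways to set to zero the entries of X outside the Hessenberg shape: in X, or
    by the substitution that defines hE. *)
Lemma kill_hom (L : comNzRingType) (s : {rmorphism {mpolyT C[hxqvar h]} -> L})
    (X : 'M[L]_n) (v : xqvar n) :
  (forall i j : 'I_n, (h j < i)%N -> X i j = 0) ->
  (forall u, s (varT C u) = hxq_value X u) ->
  s (substT (kill C h) (varT C v)) = xq_value X v.
Proof.
move=> X0 sE; rewrite substT_var; case: v => [k|t] /=; first by rewrite sE.
case: insubP => [u _ eu|]; first by rewrite sE /= eu.
rewrite not_killed ?(valP t) // negbK => /X0 ->.
by rewrite rmorph0 oppr0.
Qed.

Lemma map_gen_unip_hE (L : comNzRingType)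
    (s : {rmorphism {mpolyT C[hxqvar h]} -> L}) :
  map_mx (fun f => s (substT hE_subst f)) (gen_unip C n)
    = coef_mx (fun i j => s (substT (kill C h) (M_entry C m i j))) m.
Proof.
apply/matrixP => i j; rewrite mxE; case: (leqP i j) => [le_ij|lt_ji].
  rewrite gen_unip_lower // 2!rmorph_nat coef_mx_unip //.
rewrite (gen_unip_xij _ lt_ji) substT_var.
by rewrite (coef_mx_E (s \o substT (kill C h)) lt_ji).
Qed.

(** From left to right, N g = g X holds modulo the hE_i, so the generators go to the
    entries of X that were set to zero. From right to left, X := g^-1 N g modulo the
    first ideal has the shape of a reversed opposite M, and [coef_mx_uniq] shows both
    that the hE_i vanish there and that x_ij is sent back to itself. *)
Lemma subst_hE_idealZ f :
  (f \in idealZ C h) = (substT hE_subst f \in idealE C h).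
Proof.
apply/idP/idP => [|fJ].
  rewrite idealZE -proj_eq0 => fI; apply/eqP.
  pose s : {rmorphism _ -> _} := proj (idealE C h) \o substT (kill C h).
  pose t : {rmorphism _ -> _} := proj (idealE C h) \o substT hE_subst.
  have comm : jordan _ n *m map_mx t (gen_unip C n)
      = map_mx t (gen_unip C n) *m rev_mx (fun i j => s (M_entry C m i j)) m.
    have -> : map_mx t (gen_unip C n) = coef_mx (fun i j => s (M_entry C m i j)) m.
      exact: (map_gen_unip_hE (proj (idealE C h))).
    apply: coef_mx_commute; [exact: (M_entry_sub s) | exact: (M_entry_low s) | move=> i le_im].
    rewrite (eps_E s); apply/eqP; rewrite proj_eq0.
    have lt_in : (i < n)%N by [].
    exact: (@gen_ideal_gen _ _ xpredT (fun i : 'I_n => hE C h (leqnn n) i.+1)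
              (Ordinal lt_in)).
  apply: (gen_ideal_hom (ev := t)) fI => -[i j]; rewrite /off_hess /= => lt_hji.
  transitivity (rev_mx (fun i j => s (M_entry C m i j)) m i j).
    by rewrite -(hom_conj_jordan comm) [RHS]mxE.
  have lt_ji := leq_ltn_trans (hess_ge h j) lt_hji.
  have lt_rev : (rev_ord i < rev_ord j)%N by rewrite /=; have := ltn_ord i; lia.
  pose q : qvar n := exist _ (rev_ord i, rev_ord j) lt_rev.
  have := rev_mx_xq s (inr q); rewrite /= !rev_ordK substT_var /= insubF.
    by rewrite rmorph0 => /eqP; rewrite eq_sym oppr_eq0 => /eqP.
  rewrite not_killed // -[killed _]/(h (rev_ord (rev_ord j)) < rev_ord (rev_ord i))%N.
  by rewrite !rev_ordK lt_hji.
pose I := idealZ C h; pose X := map_mx (proj I) (conj_jordan C m).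
have off0 (i j : 'I_n) : (h j < i)%N -> X i j = 0.
  move=> lt_hji; rewrite mxE; apply/eqP; rewrite proj_eq0 idealZE.
  exact: (@gen_ideal_gen _ _ off_hess (fun p => conj_jordan C m p.1 p.2) (i, j)).
pose psi : {rmorphism _ -> _} := proj I \o substT (hxq_value (conj_jordan C m)).
have psiE u : psi (varT C u) = hxq_value X u.
  by rewrite /psi /= substT_var; case: u => [k|t];
     rewrite /= rmorphN; congr (- _); rewrite [RHS]mxE.
have hX : lower_hess X.
  by move=> i j lt_ij; rewrite mxE conj_jordan_hess // rmorph_nat.
pose s : {rmorphism _ -> _} := psi \o substT (kill C h).
have revX : rev_mx (fun i j => s (M_entry C m i j)) m = X.
  apply: xq_value_inj hX _ => [|v]; first exact: rev_mx_hess (M_entry_sub s) (M_entry_low s).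
  by rewrite -rev_mx_xq; exact: kill_hom.
have ug : lower_unip (map_mx (proj I) (gen_unip C n)).
  by move=> i j le_ij; rewrite mxE gen_unip_lower // rmorph_nat.
have NgE : jordan _ n *m map_mx (proj I) (gen_unip C n)
   = map_mx (proj I) (gen_unip C n) *m rev_mx (fun i j => s (M_entry C m i j)) m.
  by rewrite revX -map_mxM -gen_unip_conj_jordan map_mxM map_jordan.
have [gE eps0] := coef_mx_uniq (M_entry_sub s) (M_entry_low s) ug NgE.
have tauE : psi \o substT hE_subst =1 proj I.
  apply: varT_hom_ext => [c|v].
    by rewrite /= !substT_C.
  transitivity (coef_mx (fun i j => s (M_entry C m i j)) m (val v).1 (val v).2).
    rewrite /= -(map_gen_unip_hE psi) mxE; case: v => -[i j] lt_ji.
    by rewrite (gen_unip_xij _ lt_ji).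
  by rewrite gE mxE; case: v => -[i j] lt_ji; rewrite (gen_unip_xij _ lt_ji).
rewrite -proj_eq0; apply/eqP; rewrite -tauE /=.
apply: (gen_ideal_hom (ev := psi)) fJ => i _.
rewrite -[LHS]/(s (E C (leqnn n) i.+1)) -(eps_E s).
exact: eps0 (ltn_ord i).
Qed.

(** The preimages of the variables are the entries of -(g^-1 N g). *)
Lemma idealE_surj b :
  exists f, proj (idealE C h) b = proj (idealE C h) (substT hE_subst f).
Proof.
pose psi := substT (hxq_value (conj_jordan C m)); exists (psi b).
pose t : {rmorphism _ -> _} := proj (idealE C h) \o substT hE_subst.
pose s : {rmorphism _ -> _} := proj (idealE C h) \o substT (kill C h).
have tXG : map_mx t (conj_jordan C m) = rev_mx (fun i j => s (M_entry C m i j)) m.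
  apply: hom_conj_jordan; rewrite (map_gen_unip_hE (proj (idealE C h))).
  apply: coef_mx_commute; [exact: (M_entry_sub s) | exact: (M_entry_low s) | move=> i le_im].
  rewrite (eps_E s); apply/eqP; rewrite proj_eq0.
  have lt_in : (i < n)%N by [].
  exact: (@gen_ideal_gen _ _ xpredT (fun i : 'I_n => hE C h (leqnn n) i.+1)
            (Ordinal lt_in)).
suff : proj (idealE C h) =1 t \o psi by apply.
apply: varT_hom_ext => [c|v]; first by rewrite /= !substT_C.
transitivity (hxq_value (map_mx t (conj_jordan C m)) v); last first.
  rewrite /= substT_var; case: v => [k|u]; rewrite /hxq_value mxE -rmorphN //.
rewrite tXG; case: v => [k|u] /=.
  by have := rev_mx_xq s (inl k); rewrite /= substT_var.
have lt_u : ((val u).1 < (val u).2)%N by case/andP: (valP u).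
have := rev_mx_xq s (inr (exist _ (val u) lt_u)).
rewrite /= substT_var /= (insubT _ (valP u)) => <-.
by congr (proj _ (varT _ (inr _))); apply: val_inj.
Qed.
End Ideals.

(** * Ideals with monic leading terms *)

Section MonicDivision.
Variables (R : comNzRingType) (N : nat) (wv : 'I_N -> nat).
Local Notation A := {mpoly R[N]}.
Implicit Types (p q : A) (u v : 'X_{1..N}) (i : 'I_N).

Definition weight u : nat := \sum_i u i * wv i.

Definition weight_lt k p : Prop := forall u, u \in msupp p -> (weight u < k)%N.

(** u is the leading monomial of p, with coefficient 1: all other monomials of p have
    a strictly smaller weight, not only a smaller rank in some order. This makes
    products immediate. *)
Definition leads u p : Prop := weight_lt (weight u) (p - 'X_[u]).

Lemma weightD u v : weight (u + v)%MM = (weight u + weight v)%N.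
Proof. by rewrite /weight -big_split; apply: eq_bigr => i _; rewrite mnmDE mulnDl. Qed.

Lemma weight1 i : weight U_(i)%MM = wv i.
Proof.
rewrite /weight (bigD1 i) //= mnm1E eqxx mul1n big1 ?addn0 // => j ne_ji.
by rewrite mnm1E eq_sym (negPf ne_ji).
Qed.

Lemma weight_mulmn u k : weight (u *+ k)%MM = (weight u * k)%N.
Proof. by rewrite /weight big_distrl; apply: eq_bigr => i _; rewrite mulmnE mulnAC. Qed.

Lemma weight_lt0 k : weight_lt k 0.
Proof. by move=> u; rewrite msupp0. Qed.

Lemma weight_lt_leq k l p : (k <= l)%N -> weight_lt k p -> weight_lt l p.
Proof. by move=> le_kl kp u /kp lt_u; exact: leq_trans le_kl. Qed.

Lemma weight_ltD k p q : weight_lt k p -> weight_lt k q -> weight_lt k (p + q).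
Proof. by move=> kp kq u /msuppD_le; rewrite mem_cat => /orP[/kp|/kq]. Qed.

Lemma weight_ltN k p : weight_lt k p -> weight_lt k (- p).
Proof. by move=> kp u; rewrite (perm_mem (msuppN p)) => /kp. Qed.

Lemma weight_ltZ k c p : weight_lt k p -> weight_lt k (c *: p).
Proof. by move=> kp u /msuppZ_le /kp. Qed.

Lemma weight_lt_sum k (I : Type) (r : seq I) (P : pred I) (F : I -> A) :
  (forall x, P x -> weight_lt k (F x)) -> weight_lt k (\sum_(x <- r | P x) F x).
Proof.
move=> kF; apply: (big_ind (weight_lt k)) => //; first exact: weight_lt0.
exact: weight_ltD.
Qed.

Lemma weight_ltX u : weight_lt (weight u).+1 'X_[u].
Proof. by move=> v; rewrite msuppX inE => /eqP ->. Qed.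

Lemma weight_ltM k l p q : weight_lt k.+1 p -> weight_lt l q ->
  weight_lt (k + l) (p * q).
Proof.
move=> kp lq u /msuppM_le /allpairsP[[v w] /= [/kp lt_v /lq lt_w ->]].
by rewrite weightD; lia.
Qed.

Lemma leads_lt u p : leads u p -> weight_lt (weight u).+1 p.
Proof.
move=> up; rewrite -[p](subrK 'X_[u]); apply: weight_ltD; last exact: weight_ltX.
exact: weight_lt_leq up.
Qed.

Lemma leadsM u v p q : leads u p -> leads v q -> leads (u + v)%MM (p * q).
Proof.
move=> up vq; rewrite /leads mpolyXD weightD.
have -> : p * q - 'X_[u] * 'X_[v] = 'X_[u] * (q - 'X_[v]) + q * (p - 'X_[u]) by ring.
apply: weight_ltD; first by apply: weight_ltM => //; exact: weight_ltX.
by rewrite addnC; apply: weight_ltM => //; exact: leads_lt.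
Qed.

Lemma leads_refl u : leads u 'X_[u].
Proof. by rewrite /leads subrr; exact: weight_lt0. Qed.

Lemma leads1 : leads 0%MM 1.
Proof. by rewrite -mpolyX0; exact: leads_refl. Qed.

Lemma leads_exp u p k : leads u p -> leads (u *+ k)%MM (p ^+ k).
Proof.
move=> up; elim: k => [|k IHk]; first by rewrite mulm0n; exact: leads1.
by rewrite mulmS exprS; exact: leadsM.
Qed.

Variables (d : 'I_N -> nat) (G : 'I_N -> A).
Hypothesis leadG : forall i, (0 < d i)%N -> leads (U_(i) *+ d i)%MM (G i).

(** The monomial u with each power x_i^(d_i) replaced by G_i as often as possible. *)
Definition redmon u : A := \prod_i ('X_i ^+ (u i %% d i) * G i ^+ (u i %/ d i)).

Lemma leads_redmon u : leads u (redmon u).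
Proof.
rewrite [u in leads u](_ : _ = \sum_i U_(i) *+ u i)%MM; last first.
  apply/mnmP => i; rewrite mnm_sumE (bigD1 i) //= mulmnE mnm1E eqxx mul1n.
  rewrite big1 ?addn0 // => j ne_ji.
  by rewrite mulmnE mnm1E (negPf ne_ji).
rewrite /redmon; apply: (big_ind2 leads) => [|*|i _]; first exact: leads1.
  exact: leadsM.
case: (posnP (d i)) => [->|d_gt0].
  rewrite modn0 divn0 expr0 mulr1; exact/leads_exp/leads_refl.
have -> : (U_(i) *+ u i = U_(i) *+ (u i %% d i) + (U_(i) *+ d i) *+ (u i %/ d i))%MM.
  apply/mnmP => j; rewrite mnmDE !mulmnE -mulnA -mulnDr; congr (_ * _)%N.
  by rewrite {1}(divn_eq (u i) (d i)) addnC mulnC.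
apply: leadsM.
  exact/leads_exp/leads_refl.
exact/leads_exp/leadG.
Qed.

Definition redmap p : A := \sum_(u <- msupp p) p@_u *: redmon u.

Lemma redmapE k p : (msize p <= k)%N ->
  redmap p = \sum_(u : 'X_{1..N < k}) p@_u *: redmon u.
Proof.
move=> le_pk; set I : subFinType _ := 'X_{1..N < k}.
rewrite /redmap (big_mksub I) ?msupp_uniq //=; first last.
  by move=> x /msize_mdeg_lt /leq_trans; apply.
rewrite big_rmcond //= => j /memN_msupp_eq0 ->.
by rewrite scale0r.
Qed.

Fact redmap_linear : linear redmap.
Proof.
move=> c p q; pose k := maxn (msize (c *: p + q)) (maxn (msize p) (msize q)).
rewrite !(@redmapE k) ?leq_max ?leqnn ?orbT // scaler_sumr -big_split /=.
by apply: eq_bigr => u _; rewrite mcoeffD mcoeffZ scalerDl scalerA.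
Qed.
HB.instance Definition _ := GRing.isLinear.Build R A A _ redmap redmap_linear.

Lemma redmapX u : redmap 'X_[u] = redmon u.
Proof. by rewrite /redmap msuppX big_seq1 mcoeffX eqxx scale1r. Qed.

Lemma redmapM (q g : A) :
    (forall u, redmap (q * 'X_[u]) = g * redmon u) ->
  forall p, redmap (q * p) = g * redmap p.
Proof.
move=> qX p; rewrite [in LHS](mpolyE p) mulr_sumr linear_sum /= [in RHS]/redmap mulr_sumr.
by apply: eq_bigr => u _; rewrite -!scalerAr linearZ /= -qX.
Qed.

Lemma redmap_var i p : d i = 0%N -> redmap ('X_i * p) = 'X_i * redmap p.
Proof.
move=> di; apply: redmapM => u; rewrite -mpolyXD redmapX /redmon.
rewrite !(bigD1 i (P := xpredT)) //= mnmDE mnm1E eqxx di !modn0 !divn0 add1n exprS.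
rewrite -!mulrA; congr (_ * (_ * (_ * _))); apply: eq_bigr => j ne_ji.
by rewrite mnmDE mnm1E eq_sym (negPf ne_ji).
Qed.

Lemma redmap_G i p : (0 < d i)%N -> redmap ('X_i ^+ d i * p) = G i * redmap p.
Proof.
move=> d_gt0; apply: redmapM => u.
rewrite mpolyXn -mpolyXD redmapX /redmon.
rewrite !(bigD1 i (P := xpredT)) //= mnmDE mulmnE mnm1E eqxx mul1n.
rewrite modnDl divnDl ?dvdnn // divnn d_gt0 add1n exprS.
rewrite mulrCA -mulrA; congr (_ * (_ * _)).
by apply: eq_bigr => j ne_ji; rewrite mnmDE mulmnE mnm1E eq_sym (negPf ne_ji).
Qed.

(** Hence [redmap] is unipotent for the filtration by weight, and bijective. *)
Lemma redmap_sub k p : weight_lt k.+1 p -> weight_lt k (p - redmap p).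
Proof.
move=> kp; rewrite {1}(mpolyE p) /redmap -sumrB big_seq.
apply: weight_lt_sum => u /kp lt_uk; rewrite -scalerBr -opprB scalerN.
apply/weight_ltN/weight_ltZ.
by apply: (@weight_lt_leq (weight u) k) => //; exact: leads_redmon.
Qed.

Lemma weight_bound p : exists k, weight_lt k p.
Proof.
exists (\max_(u <- msupp p) (weight u).+1)%N => u up.
by rewrite (big_rem u) //= leq_max ltnSn.
Qed.

Lemma weight_lt_eq0 p : weight_lt 0 p -> p = 0.
Proof.
move=> p0; apply/eqP; rewrite -msupp_eq0; case E: (msupp p) => [//|u r].
by have := p0 u; rewrite E mem_head => /(_ isT).
Qed.

Lemma redmap_inj : injective redmap.
Proof.
apply: raddf_inj => p; have [k] := weight_bound p.
elim: k => [/weight_lt_eq0 //|k IHk] kp p0.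
by apply: IHk => //; rewrite -[p]subr0 -p0; exact: redmap_sub.
Qed.

Lemma redmap_surj p : exists q, redmap q = p.
Proof.
have [k] := weight_bound p; elim: k p => [|k IHk] p.
  by move/weight_lt_eq0 ->; exists 0; rewrite raddf0.
move/redmap_sub/IHk => [q qE]; exists (p + q).
by rewrite raddfD /= qE addrC subrK.
Qed.

Section Ideal.
Implicit Types U : pred 'I_N.

Definition monic_gen i : A := if (0 < d i)%N then G i else 'X_i.

Definition monic_ideal U : pred A :=
  gen_ideal [pred i | (0 < d i)%N || U i] monic_gen.

Definition mono_in U u : bool :=
  [exists i, (0 < d i <= u i)%N || [&& d i == 0%N, U i & (0 < u i)%N]].

(** [redmap] sends x_i^(d_i) p to G_i times the image of p, and commutes with the
    variables for which d_i = 0. So it maps a monomial ideal onto the ideal of the G_i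
    and of the variables in U. *)
Lemma monic_idealP U f : reflect
  (exists2 p, redmap p = f & forall u, u \in msupp p -> mono_in U u)
  (f \in monic_ideal U).
Proof.
apply: (iffP idP) => [/asboolP[c ->]|[p <- Up]]; last first.
  apply/asboolP.
  suff [c cE] : exists c, redmap p
      = \sum_i c i * (if (0 < d i)%N || U i then monic_gen i else 0).
    exists c; rewrite cE [RHS]big_mkcond; apply: eq_bigr => i _.
    by rewrite /=; case: ifP => // _; rewrite mulr0.
  rewrite /redmap big_seq.
  apply: (big_ind (fun f => exists c, f = \sum_i c i * _)).
  - by exists (fun=> 0); rewrite big1 // => i _; rewrite mul0r.
  - move=> _ _ [c1 ->] [c2 ->]; exists (fun i => c1 i + c2 i).
    by rewrite -big_split; apply: eq_bigr => i _; rewrite mulrDl.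
  move=> u /Up /existsP[i ui].
  have [q qE] : exists q, redmon u = q * monic_gen i.
    rewrite -redmapX /monic_gen; case/orP: ui => [/andP[d_gt0 le_di]|].
      have -> : u = (U_(i) *+ d i + (u - U_(i) *+ d i))%MM.
        rewrite addmC submK //; apply/mnm_lepP => j.
        by rewrite mulmnE mnm1E; case: eqP => [<-|_]; rewrite ?mul1n.
      by rewrite mpolyXD -mpolyXn redmap_G // d_gt0 mulrC; eexists.
    case/and3P=> /eqP di _ ui; have -> : u = (U_(i) + (u - U_(i)))%MM.
      rewrite addmC submK //; apply/mnm_lepP => j.
      by rewrite mnm1E; case: eqP => [<-|_].
    by rewrite mpolyXD redmap_var // di mulrC; eexists.
  exists (fun j => (p@_u *: q) *+ (j == i)); rewrite (bigD1 i) //= big1 ?addr0.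
    rewrite eqxx mulr1n -scalerAl; case: ifP => [_|/negP[]]; first by rewrite -qE.
    by case/orP: ui => [/andP[-> _]|/and3P[_ -> _]]; rewrite ?orbT.
  by move=> j /negPf ->; rewrite mul0r.
apply: (big_ind (fun f => exists2 p, redmap p = f & _)).
- by exists 0; [rewrite raddf0 | move=> u; rewrite msupp0].
- move=> _ _ [p <- Up] [q <- Uq]; exists (p + q); first by rewrite raddfD.
  by move=> u /msuppD_le; rewrite mem_cat => /orP[/Up|/Uq].
move=> i /= diU; have [a <-] := redmap_surj (c i); rewrite /monic_gen.
case: ifP => [d_gt0|d0].
  exists ('X_i ^+ d i * a); first by rewrite redmap_G // mulrC.
  move=> u; rewrite mulrC mpolyXn (perm_mem (msuppMX _ _)) => /mapP[v _ ->].
  apply/existsP; exists i; rewrite d_gt0 mnmDE mulmnE mnm1E eqxx mul1n.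
  by rewrite leq_addr.
have di : d i = 0%N by apply/eqP; rewrite -leqn0 leqNgt d0.
exists ('X_i * a); first by rewrite redmap_var // mulrC.
move=> u; rewrite mulrC (perm_mem (msuppMX _ _)) => /mapP[v _ ->].
apply/existsP; exists i; rewrite di eqxx mnmDE mnm1E eqxx /= addn_gt0 /=.
by move: diU; rewrite di /= => ->.
Qed.

Lemma monic_ideal_lin U x f g :
  f \in monic_ideal U -> g \in monic_ideal U -> x * f + g \in monic_ideal U.
Proof. exact: gen_ideal_lin. Qed.

(** A variable that is not among the generators of a monomial ideal is regular modulo
    that ideal. *)
Lemma monic_ideal_varI U i f : d i = 0%N -> ~~ U i ->
  'X_i * f \in monic_ideal U -> f \in monic_ideal U.
Proof.
move=> di nUi /monic_idealP[q qE Uq]; have [p pE] := redmap_surj f.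
have {qE} qE : q = 'X_i * p by apply: redmap_inj; rewrite qE redmap_var // pE.
apply/monic_idealP; exists p => // u up.
have : (U_(i) + u)%MM \in msupp q.
  by rewrite qE mulrC (perm_mem (msuppMX _ _)); apply/mapP; exists u.
move=> /Uq /existsP[j]; rewrite mnmDE mnm1E; case: eqVneq => [<-|_ uj].
  by rewrite di (negPf nUi).
by apply/existsP; exists j.
Qed.

(** Regularity descends along the regular variable x_i: if D f is in the ideal, then f
    is x_i f_1 modulo it, with D f_1 again in the ideal, and so on. So f lies in the
    sum of the ideal and of (x_i^k) for all k, and for monomial ideals the
    intersection of these sums is the ideal itself. *)
Lemma monic_ideal_descent U i D : d i = 0%N -> ~~ U i ->
    (forall f, D * f \in monic_ideal (predU1 i U) -> f \in monic_ideal (predU1 i U)) ->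
  forall f, D * f \in monic_ideal U -> f \in monic_ideal U.
Proof.
move=> di nUi nzd f Df.
have step k : exists2 g, f - 'X_i ^+ k * g \in monic_ideal U & D * g \in monic_ideal U.
  elim: k => [|k [g fg Dg]].
    exists f => //; rewrite expr0 mul1r subrr.
    by apply/monic_idealP; exists 0 => [|u]; rewrite ?raddf0 ?msupp0.
  have : D * g \in monic_ideal (predU1 i U).
    have /monic_idealP[p pE Up] := Dg; apply/monic_idealP; exists p => // u /Up.
    case/existsP=> j uj; apply/existsP; exists j.
    case/orP: uj => [->//|/and3P[-> Uj ->]].
    by rewrite !inE -[U j]/(j \in U) in Uj *; rewrite Uj !orbT.
  move/nzd => /asboolP[c gE].
  have gEU : g - 'X_i * c i \in monic_ideal U.
    apply/asboolP; exists c; rewrite {1}gE (bigD1 i) /=; last by rewrite eqxx orbT.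
    have -> : monic_gen i = 'X_i by rewrite /monic_gen di.
    rewrite ['X_i * _]mulrC addrAC subrr add0r; apply: eq_bigl => j.
    rewrite andb_orl [X in _ || X]andb_orl; case: eqVneq => [->|]; last by rewrite !andbT.
    by rewrite di (negPf nUi).
  exists (c i).
    have -> : f - 'X_i ^+ k.+1 * c i
        = 'X_i ^+ k * (g - 'X_i * c i) + (f - 'X_i ^+ k * g) by rewrite exprSr; ring.
    exact: monic_ideal_lin.
  apply: (monic_ideal_varI di nUi).
  have -> : 'X_i * (D * c i) = - D * (g - 'X_i * c i) + D * g by ring.
  exact: monic_ideal_lin.
(* A monomial u of p survives modulo x_i^k when k exceeds its degree in x_i. *)
have [p pE] := redmap_surj f; apply/monic_idealP; exists p => // u up.
have [g /monic_idealP[q qE Uq] _] := step (u i).+1.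
have [r rE] := redmap_surj g.
have pqr : p = q + 'X_[U_(i) *+ (u i).+1] * r.
  apply: redmap_inj; rewrite raddfD /= qE pE -mpolyXn.
  suff -> k : redmap ('X_i ^+ k * r) = 'X_i ^+ k * g by rewrite subrK.
  elim: k => [|k IHk]; first by rewrite !expr0 !mul1r.
  by rewrite !exprS -!mulrA redmap_var // IHk.
move: up; rewrite pqr => /msuppD_le; rewrite mem_cat => /orP[/Uq //|].
rewrite mulrC (perm_mem (msuppMX _ _)) => /mapP[v _ uE].
have /(congr1 (fun w : 'X_{1..N} => w i)) := uE.
by rewrite mnmDE mulmnE mnm1E eqxx mul1n; lia.
Qed.

Lemma eq_monic_ideal U U' : U =1 U' -> monic_ideal U =i monic_ideal U'.
Proof. by move=> eqU; apply: eq_gen_ideal => // i; rewrite /= eqU. Qed.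

Lemma monic_ideal_nzd U U' D : {subset U <= U'} -> (forall i, U' i -> d i = 0%N) ->
    (forall f, D * f \in monic_ideal U' -> f \in monic_ideal U') ->
  forall f, D * f \in monic_ideal U -> f \in monic_ideal U.
Proof.
move=> sUU' dU' nzd'; move: {2}#|_| (erefl #|[pred i | U' i && ~~ U i]|) => k.
elim: k U sUU' => [|k IHk] U sUU' cardU.
  have eqU : U =1 U'.
    move=> i; apply/idP/idP => [|U'i]; first exact: sUU'.
    by have /card0_eq/(_ i) := cardU; rewrite !inE U'i => /negbT /negbNE.
  by move=> f; rewrite !(eq_monic_ideal eqU); exact: nzd'.
have : (0 < #|[pred i | U' i && ~~ U i]|)%N by rewrite cardU.
case/card_gt0P => i; rewrite inE => /andP[U'i nUi]; apply: (monic_ideal_descent (dU' i U'i) nUi).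
apply: IHk => [j|].
  by rewrite !inE => /predU1P[->//|]; exact: sUU'.
apply/eqP; rewrite -eqSS -cardU (cardD1 i [pred i | U' i && ~~ U i]) inE U'i nUi.
rewrite add1n eqSS; apply/eqP; apply: eq_card => j.
by rewrite !inE /=; case: (j == i); rewrite /= ?andbF.
Qed.

End Ideal.
End MonicDivision.

(** * The equations of nilpotency have monic leading terms *)

Section NilpotencyEquations.
Variables (C : fieldType) (m : nat).
Local Notation n := m.+1.
Local Notation A := {mpolyT C[xqvar n]}.
Local Notation X := (rev_mx (M_entry C m) m).

(** The relation N g = g X, for g with the rows e_0, e_0 X, e_0 X^2, ..., amounts to
    e_0 X^n = 0; these n equations generate the same ideal as E_1, ..., E_n. *)
Definition nilp_eq (j : 'I_n) : A := krylov (e0 A m) X n 0 j.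

(** The weights increase with the index of the column of X, but are all close to n^2.
    So up to degree n in the x_s, a monomial of smaller degree has a smaller weight,
    and for equal degrees the later columns weigh more. *)
Definition xq_weight (i : 'I_#|xqvar n|) : nat :=
  if enum_val i is inl k then (n ^ 2 + rev_ord k)%N else 0%N.

Definition xq_deg (i : 'I_#|xqvar n|) : nat :=
  if enum_val i is inl k then k.+1 else 0%N.

Definition xq_monic (i : 'I_#|xqvar n|) : A :=
  if enum_val i is inl k then (-1) ^+ k.+1 * nilp_eq (rev_ord k) else 0.

Lemma xq_weightE v : xq_weight (enum_rank v)
  = if v is inl k then (n ^ 2 + rev_ord k)%N else 0%N.
Proof. by rewrite /xq_weight enum_rankK. Qed.

Local Notation wlt := (weight_lt xq_weight).

Lemma revM_hess : lower_hess X.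
Proof. exact: rev_mx_hess (M_entry_sub idfun) (M_entry_low idfun). Qed.

Lemma revM_diag (j : 'I_n) : X j j = - varT C (inl (rev_ord j)).
Proof. by rewrite [varT _ _](rev_mx_xq idfun) /= rev_ordK opprK. Qed.

Lemma revM_low (i j : 'I_n) (lt_rev : (rev_ord i < rev_ord j)%N) :
  X i j = - varT C (inr (exist _ (rev_ord i, rev_ord j) lt_rev)).
Proof. by rewrite [varT _ _](rev_mx_xq idfun) /= !rev_ordK opprK. Qed.

Lemma weight_x (j : 'I_n) : wlt (n ^ 2 + j).+1 (varT C (inl (rev_ord j))).
Proof.
have := @weight_ltX C _ xq_weight U_(enum_rank (inl (rev_ord j) : xqvar n))%MM.
by rewrite weight1 xq_weightE rev_ordK.
Qed.

Lemma weight_revM_low (i j : 'I_n) : (j < i)%N -> wlt 1 (X i j).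
Proof.
move=> lt_ji; have lt_rev : (rev_ord i < rev_ord j)%N.
  by rewrite /=; have := ltn_ord i; lia.
rewrite (revM_low lt_rev); apply: weight_ltN.
have := @weight_ltX C _ xq_weight
  U_(enum_rank (inr (exist _ (rev_ord i, rev_ord j) lt_rev) : xqvar n))%MM.
by rewrite weight1 xq_weightE.
Qed.

(** A sum over paths from 0 to j with k steps: a path goes up by one step with
    coefficient 1, stays with coefficient -x, or goes down with a coefficient q of
    weight 0. The path that first climbs to j and stays there has the largest weight. *)
Lemma krylov_leads k (j : 'I_n) : (j <= k <= n)%N ->
  wlt ((k - j) * (n ^ 2 + j))
    (krylov (e0 A m) X k 0 j - (- varT C (inl (rev_ord j))) ^+ (k - j)).
Proof.
elim: k j => [|k IHk] j /andP[le_jk le_kn].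
  rewrite (krylov_hess revM_hess) //.
  by rewrite eqn_leq leq0n le_jk sub0n subrr; exact: weight_lt0.
move: le_jk; rewrite leq_eqVlt => /orP[/eqP ejk|lt_jk].
  rewrite (krylov_hess revM_hess) ?ejk // eqxx subnn subrr; exact: weight_lt0.
have bound (i : 'I_n) : wlt ((k - i) * (n ^ 2 + i)).+1 (krylov (e0 A m) X k 0 i).
  case: (leqP i k) => [le_ik|lt_ki]; last first.
    by rewrite (krylov_hess revM_hess) 1?ltnW // ltn_eqF //; exact: weight_lt0.
  rewrite -[krylov _ _ _ _ _](subrK ((- varT C (inl (rev_ord i))) ^+ (k - i))).
  apply: weight_ltD.
    by apply: weight_lt_leq (IHk i _) => //; rewrite le_ik ltnW.
  elim: (k - i)%N => [|l IHl].
    by rewrite expr0 mul0n; have := @weight_ltX C _ xq_weight 0%MM;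
       rewrite mpolyX0 /weight big1 // => y _; rewrite mnm0E mul0n.
  rewrite exprS mulSn -addnS; apply: weight_ltM => //.
  exact/weight_ltN/weight_x.
rewrite /krylov iterS -/(krylov _ _ k) mxE (bigD1 j) //= revM_diag addrAC.
rewrite subSn // exprSr -mulrBl mulSn addnC.
apply: weight_ltD.
  rewrite mulrC addnC; apply: weight_ltM; first exact/weight_ltN/weight_x.
  by apply: IHk; rewrite -ltnS lt_jk ltnW.
apply: weight_lt_sum => i ne_ij.
have lt_in := ltn_ord i; have lt_jn := ltn_ord j.
case: (ltngtP i j) => [lt_ij|lt_ji|/val_inj/eqP]; last by rewrite (negPf ne_ij).
  rewrite (revM_hess lt_ij); case: eqP => [ej|_]; last by rewrite mulr0; exact: weight_lt0.
  rewrite mulr1; apply: weight_lt_leq (bound i).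
  rewrite ej addnS subnS; have : (i < k)%N by lia.
  case: (k - i)%N (subn_gt0 i k) => [|e] <- //= _; rewrite mulSn; nia.
case: (leqP i k) => [le_ik|lt_ki]; last first.
  by rewrite (krylov_hess revM_hess) 1?ltnW // ltn_eqF // mul0r; exact: weight_lt0.
rewrite mulrC; apply: weight_lt_leq (weight_ltM (weight_revM_low lt_ji) (bound i)).
rewrite add0n; have -> : (k - j = (k - i) + (i - j))%N by lia.
have : (0 < i - j)%N by rewrite subn_gt0.
move: (k - i)%N (i - j)%N (leq_subr i k) => e1 e2 le_e1 e2_gt0.
rewrite mulnDl; nia.
Qed.

Lemma xq_monic_leads i : (0 < xq_deg i)%N ->
  leads xq_weight (U_(i) *+ xq_deg i)%MM (xq_monic i).
Proof.
rewrite -(enum_valK i); case: (enum_val i) => [k|t]; rewrite /xq_deg enum_rankK // => _.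
rewrite /leads weight_mulmn weight1 xq_weightE /xq_monic enum_rankK.
rewrite -mpolyXn -/(varT _ _).
have le_k : (rev_ord k <= n <= n)%N by rewrite leqnn andbT ltnW ?ltn_ord.
have kE : (n - rev_ord k = k.+1)%N by rewrite /= subnBA ?addKn // ltn_ord.
have := krylov_leads le_k; rewrite kE rev_ordK (exprNn (varT _ _)) -/(nilp_eq _) mulnC.
set p := nilp_eq _; set x := varT _ _ ^+ _ => px.
have -> : (-1) ^+ k.+1 * p - x = (-1) ^+ k.+1 * (p - (-1) ^+ k.+1 * x).
  by rewrite mulrBr signrMK.
move: px; case: (odd k.+1) (signr_odd A k.+1) => <-;
  rewrite ?expr1 ?expr0 ?mulN1r ?mul1r // => px.
exact: weight_ltN.
Qed.

Definition qpred (V : pred (qvar n)) (i : 'I_#|xqvar n|) : bool :=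
  if enum_val i is inr t then V t else false.

Definition nilp_ideal (V : pred (qvar n)) : pred A :=
  monic_ideal xq_deg xq_monic (qpred V).

Lemma qpred_deg V i : qpred V i -> xq_deg i = 0%N.
Proof. by rewrite /qpred /xq_deg; case: (enum_val i). Qed.

Lemma nilp_ideal_varI (V : pred (qvar n)) t f : ~~ V t ->
  varT C (inr t) * f \in nilp_ideal V -> f \in nilp_ideal V.
Proof.
move=> nVt; apply: (monic_ideal_varI xq_monic_leads).
  by rewrite /xq_deg enum_rankK.
by rewrite /qpred enum_rankK.
Qed.

Lemma nilp_ideal_nzd (V V' : pred (qvar n)) D : {subset V <= V'} ->
    (forall f, D * f \in nilp_ideal V' -> f \in nilp_ideal V') ->
  forall f, D * f \in nilp_ideal V -> f \in nilp_ideal V.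
Proof.
move=> sVV'; apply: (monic_ideal_nzd xq_monic_leads) => [i|i /qpred_deg //].
by rewrite /in_mem /= /qpred; case: (enum_val i) => [//|t]; exact: sVV'.
Qed.

Lemma nilp_eq_in V j : nilp_eq j \in nilp_ideal V.
Proof.
pose i : 'I_#|xqvar n| := enum_rank (inl (rev_ord j)).
have iP : [pred i | (0 < xq_deg i)%N || qpred V i] i by rewrite /= /xq_deg enum_rankK.
have := gen_ideal_gen (monic_gen xq_deg xq_monic) iP.
rewrite /monic_gen /xq_deg /xq_monic enum_rankK /= => Gi.
have := gen_ideal_lin ((-1) ^+ (rev_ord j).+1) Gi
  (gen_ideal_lin (-1) Gi Gi).
by rewrite mulN1r addNr addr0 rev_ordK signrMK.
Qed.

Lemma nilp_var_in (V : pred (qvar n)) t : V t -> varT C (inr t) \in nilp_ideal V.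
Proof.
move=> Vt; pose i : 'I_#|xqvar n| := enum_rank (inr t).
have iP : [pred i | (0 < xq_deg i)%N || qpred V i] i.
  by rewrite /= /xq_deg /qpred enum_rankK.
have := gen_ideal_gen (monic_gen xq_deg xq_monic) iP.
by rewrite /monic_gen /xq_deg enum_rankK.
Qed.

Lemma nilp_ideal_hom (V : pred (qvar n)) (L : comNzRingType) (s : {rmorphism A -> L}) :
    krylov (e0 L m) (map_mx s X) n = 0 ->
    (forall t, V t -> s (varT C (inr t)) = 0) ->
  forall f, f \in nilp_ideal V -> s f = 0.
Proof.
move=> nilp sV; apply: gen_ideal_hom => i; rewrite /monic_gen /= -(enum_valK i).
rewrite -(map_e0 s) -map_krylov in nilp.
rewrite /xq_deg /xq_monic /qpred enum_rankK; case: (enum_val i) => [k _|t /sV //].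
have sE : s (nilp_eq (rev_ord k)) = 0.
  have := congr1 (fun r : 'rV_n => r 0 (rev_ord k)) nilp.
  by rewrite [LHS]mxE [RHS]mxE.
by rewrite rmorphM sE mulr0.
Qed.

Lemma nilp_ideal_closed V : idealr_closed (nilp_ideal V).
Proof.
pose ev0 : {rmorphism A -> C} := evalT (fun=> 0).
have ev0V v : ev0 (varT C v) = 0 by rewrite /ev0 /= /evalT /varT mevalXU.
have ev0X : map_mx ev0 X = jordan C n.
  apply: xq_value_inj => [i j lt_ij|i j lt_ij|v].
  - by rewrite mxE revM_hess // rmorph_nat.
  - by rewrite mxE.
  have -> : xq_value (map_mx ev0 X) v = ev0 (varT C v).
    by rewrite [varT _ _](rev_mx_xq idfun); case: v => [k|t]; rewrite /xq_value mxE rmorphN.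
  rewrite ev0V; case: v => [k|t]; rewrite /= mxE ltn_eqF ?oppr0 //=.
  by rewrite ltnS leq_sub2l //; exact/ltnW/(valP t).
apply: (gen_ideal_closed (ev := ev0)) => i Pi.
apply: (nilp_ideal_hom (V := V) (s := ev0)).
- rewrite ev0X; have := @row_krylov C m 1%:M (jordan C n) (e0 C m).
  rewrite mulmx1 mul1mx => -[] //; apply/rowP => j.
  by rewrite !mxE eq_sym.
- by [].
exact: gen_ideal_gen.
Qed.

HB.instance Definition _ V := isIdealr.Build A (nilp_ideal V) (nilp_ideal_closed V).
Definition nilp_idealr V : idealr A := nilp_ideal V.

End NilpotencyEquations.

(** * Leading minors of tridiagonal matrices *)

Definition upper_tri (L : pzRingType) n (U : 'M[L]_n) : Prop :=
  forall i j : 'I_n, (j < i)%N -> U i j = 0.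

Definition lead (L : pzRingType) n (k : 'I_n) (A : 'M[L]_n) : 'M[L]_k.+1 :=
  mxsub (widen_ord (ltn_ord k)) (widen_ord (ltn_ord k)) A.

Definition rev_rows (L : pzRingType) n (A : 'M[L]_n) : 'M[L]_n :=
  \matrix_(i, j) A (rev_ord i) j.

Section LeadingMinors.
Variables (L : comNzRingType) (n : nat).
Implicit Types (A U : 'M[L]_n) (k : 'I_n).

Lemma lead_sum k (F : 'I_n -> L) : (forall i : 'I_n, (k < i)%N -> F i = 0) ->
  \sum_i F i = \sum_(i < k.+1) F (widen_ord (ltn_ord k) i).
Proof.
move=> F0; rewrite (bigID (fun i : 'I_n => (i < k.+1)%N)) /=.
rewrite [X in _ + X]big1 ?addr0 => [|i]; last by rewrite ltnS -ltnNge; exact: F0.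
exact: (big_ord_narrow (ltn_ord k)).
Qed.

Lemma lead_mul_upper k A U : upper_tri U ->
  lead k (A *m U) = lead k A *m lead k U.
Proof.
move=> upU; apply/matrixP => i j; rewrite !mxE (@lead_sum k) => [|l lt_kl].
  by apply: eq_bigr => l _; rewrite !mxE.
by rewrite upU ?mulr0 //; exact: leq_trans (ltn_ord j) lt_kl.
Qed.

Lemma det_lead_upper k U : upper_tri U ->
  \det (lead k U)
    = \prod_(i < k.+1) U (widen_ord (ltn_ord k) i) (widen_ord (ltn_ord k) i).
Proof.
move=> upU; rewrite -det_tr det_trig.
  by apply: eq_bigr => i _; rewrite !mxE.
by apply/is_trig_mxP => i j lt_ij; rewrite !mxE upU.
Qed.

Lemma det_lead_trig k A : is_trig_mx A ->
  \det (lead k A)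
    = \prod_(i < k.+1) A (widen_ord (ltn_ord k) i) (widen_ord (ltn_ord k) i).
Proof.
move=> /is_trig_mxP trA; rewrite det_trig.
  by apply: eq_bigr => i _; rewrite !mxE.
by apply/is_trig_mxP => i j lt_ij; rewrite !mxE trA.
Qed.

Lemma map_lead (L' : comNzRingType) (s : {rmorphism L -> L'}) k A :
  map_mx s (lead k A) = lead k (map_mx s A).
Proof. by apply/matrixP => i j; rewrite !mxE. Qed.

Lemma map_rev_rows (L' : comNzRingType) (s : {rmorphism L -> L'}) A :
  map_mx s (rev_rows A) = rev_rows (map_mx s A).
Proof. by apply/matrixP => i j; rewrite !mxE. Qed.

Lemma rev_rows_mul A U : rev_rows (A *m U) = rev_rows A *m U.
Proof. by apply/matrixP => i j; rewrite !mxE; apply: eq_bigr => k _; rewrite mxE. Qed.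
End LeadingMinors.

Section Tridiagonal.
Variables (L : comNzRingType) (m : nat) (g X : 'M[L]_m.+1).
Local Notation n := m.+1.
Hypotheses (ug : lower_unip g) (NgE : jordan L n *m g = g *m X).
Hypothesis X0 : forall i j : 'I_n, (j.+1 < i)%N -> X i j = 0.

Definition subdiag (l : 'I_m) : L := X (lift ord0 l) (widen_ord (leqnSn m) l).

Definition colpow k : 'cV[L]_n := iter k (mulmx X) (delta_mx 0 0).

Lemma colpow_upper k (i : 'I_n) : (k < i)%N -> colpow k i 0 = 0.
Proof.
elim: k i => [|k IHk] i lt_ki.
  by rewrite mxE -!val_eqE /= gtn_eqF.
rewrite mxE big1 // => l _; case: (ltnP k l) => [lt_kl|le_lk].
  by rewrite [X in _ * X]IHk ?mulr0.
by rewrite X0 ?mul0r //; exact: leq_ltn_trans lt_ki.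
Qed.

Lemma colpow_diag (k : 'I_n) :
  colpow k k 0 = \prod_(l < m | (l < k)%N) subdiag l.
Proof.
case: k => k lt_kn /=; elim: k lt_kn => [|k IHk] lt_kn.
  by rewrite big_pred0 // mxE -!val_eqE.
have lt_km : (k < m)%N by [].
rewrite (bigD1 (Ordinal lt_km)) //= mxE.
rewrite (bigD1 (widen_ord (leqnSn m) (Ordinal lt_km))) //=.
rewrite big1 ?addr0 => [|l ne_lk]; last first.
  case: (ltngtP k l) => [lt_kl|lt_lk|ekl].
  - by rewrite [X in _ * X]colpow_upper ?mulr0.
  - by rewrite X0 ?mul0r.
  by rewrite -val_eqE /= -ekl eqxx in ne_lk.
congr (_ * _); first by congr (X _ _); apply: val_inj; rewrite /= ?lift0.
have lt_kn' : (k < n)%N by exact: ltnW.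
transitivity (colpow k (Ordinal lt_kn') 0).
  by rewrite -/(colpow k); congr (colpow k _ 0); apply: val_inj.
rewrite IHk; apply: eq_bigl => l.
by rewrite -val_eqE /= ltnS ltn_neqAle andbC.
Qed.

Lemma mul_colpow k (i : 'I_n) :
  (g *m colpow k) i 0 = if insub (i + k)%N is Some l then g l 0 else 0.
Proof.
elim: k i => [|k IHk] i.
  by rewrite addn0 valK /colpow /= -colE mxE.
rewrite /colpow iterS -/(colpow k) mulmxA -NgE -mulmxA.
rewrite -[RHS]mulr1; move: (IHk) => {}IHk.
transitivity (if insub i.+1 is Some l then (g *m colpow k) l 0 else 0).
  rewrite mxE; case: insubP => [l _ el|].
    rewrite (bigD1 l) //= big1 ?addr0 => [|l' ne_l]; rewrite mxE.
      by rewrite el eqxx mul1r.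
    by rewrite -el val_eqE (negPf ne_l) mul0r.
  rewrite -leqNgt => le_mi; rewrite big1 // => l _; rewrite mxE.
  by rewrite ltn_eqF ?mul0r // (leq_trans (ltn_ord l)).
rewrite mulr1; case: insubP => [l _ el|]; first by rewrite IHk el addSnnS.
rewrite -leqNgt => le_mi; rewrite insubF // ltnNge addnS (leq_trans le_mi) //.
by rewrite ltnS leq_addr.
Qed.

(** The entry (m, 0) of X^m is the product of the subdiagonal of X. On the other hand
    X^m = g^-1 N^m g, and N^m has its only entry in the upper right corner. *)
Lemma corner_dvd : \adj g ord_max 0 * g ord_max 0 = \prod_l subdiag l.
Proof.
have -> : \prod_l subdiag l = colpow m ord_max 0.
  by rewrite (colpow_diag ord_max); apply: eq_bigl => l; rewrite ltn_ord.
have -> : colpow m = \adj g *m (g *m colpow m).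
  by rewrite mulmxA lower_unip_adj // mul1mx.
rewrite [RHS]mxE (bigD1 0) //= big1 ?addr0 => [|i nz_i]; rewrite mul_colpow.
  rewrite /= add0n (insubT (fun x => x < n)%N (ltnSn m)) /=.
  by congr (_ * g _ _); apply: val_inj.
rewrite insubF ?mulr0 //; apply/negbTE; rewrite -leqNgt.
by case: i nz_i => -[|i] //= lt_i _; rewrite addSn ltnS leq_addl.
Qed.

(** Let U have the columns X^j e_0; it is upper triangular with products of subdiagonal
    entries on its diagonal. The columns of g U are N^j applied to the first column
    of g, so that g U with its rows reversed is lower triangular, with the corner
    entry of g all along the diagonal. Compare the leading minors. *)
Lemma lead_minor_dvd (k : 'I_n) : exists e : 'I_m -> nat,
  \det (lead k (rev_rows g)) * \prod_l subdiag l ^+ e l = g ord_max 0 ^+ k.+1.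
Proof.
pose U : 'M[L]_n := \matrix_(i, j) colpow j i 0.
have upU : upper_tri U by move=> i j lt_ji; rewrite mxE colpow_upper.
exists (fun l => \sum_(i < k.+1) (l < i)%N)%N.
have UE : \det (lead k U) = \prod_l subdiag l ^+ (\sum_(i < k.+1) (l < i)%N)%N.
  rewrite (det_lead_upper k upU).
  have Ud (i : 'I_n) : U i i = \prod_(l < m) if (l < i)%N then subdiag l else 1.
    by rewrite mxE colpow_diag big_mkcond.
  rewrite (eq_bigr _ (fun i _ => Ud _)).
  rewrite exchange_big; apply: eq_bigr => l _ /=.
  rewrite -prodrXr; apply: eq_bigr => i _.
  by case: ifP.
rewrite -UE -det_mulmx -lead_mul_upper // -rev_rows_mul.
have gUE i j : rev_rows (g *m U) i j
    = if insub (rev_ord i + j)%N is Some l then g l 0 else 0.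
  rewrite mxE -mul_colpow mxE [RHS]mxE; apply: eq_bigr => l _.
  by rewrite mxE.
rewrite det_lead_trig.
  transitivity (\prod_(i < k.+1) g ord_max 0); last by rewrite prodr_const card_ord.
  apply: eq_bigr => i _; rewrite gUE.
  have lt_in : (i < n)%N by exact: leq_trans (ltn_ord k).
  have ei : (n - i.+1 + i = m)%N by rewrite subSS subnK.
  by rewrite insubT /= ?ei // => ?; congr (g _ 0); apply: val_inj.
apply/is_trig_mxP => i j lt_ij; rewrite gUE insubF //.
by rewrite /= subSS; have := ltn_ord i; lia.
Qed.

End Tridiagonal.

(** * Regularity of the leading minors *)

Definition nzd (A : comNzRingType) (J : pred A) (z : A) : Prop :=
  forall f, z * f \in J -> f \in J.

Section Nzd.
Variables (K : comNzRingType) (A : comAlgType K) (J : idealr A).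
Implicit Types z w : A.

Lemma nzd1 : nzd J 1. Proof. by move=> f; rewrite mul1r. Qed.

Lemma nzdM z w : nzd J z -> nzd J w -> nzd J (z * w).
Proof. by move=> nz nw f; rewrite -mulrA => /nz /nw. Qed.

Lemma nzd_exp z k : nzd J z -> nzd J (z ^+ k).
Proof.
by move=> nz; elim: k => [|k IHk]; [exact: nzd1 | rewrite exprS; exact: nzdM].
Qed.

Lemma nzd_prod (I : Type) (r : seq I) (P : pred I) (F : I -> A) :
  (forall i, P i -> nzd J (F i)) -> nzd J (\prod_(i <- r | P i) F i).
Proof. by move=> nF; apply: (big_ind (nzd J)) => //; [exact: nzd1 | exact: nzdM]. Qed.

Lemma nzd_dvd z w v : proj J (v * w) = proj J z -> nzd J z -> nzd J w.
Proof.
move=> eq_vw nz f wfJ; apply: nz.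
have zJ : z - v * w \in J by rewrite -proj_eq0 rmorphB /= eq_vw subrr.
have -> : z * f = f * (z - v * w) + v * (w * f) by ring.
by apply: rpredD; exact: idealMr.
Qed.
End Nzd.

Section LeadingMinorsNzd.
Variables (C : fieldType) (m : nat).
Local Notation n := m.+1.
Local Notation A := {mpolyT C[xqvar n]}.
Local Notation X := (rev_mx (M_entry C m) m).
Local Notation g := (coef_mx (M_entry C m) m).

Lemma coef_mx_mod (V : pred (qvar n)) : let p := proj (nilp_idealr C V) in
  jordan _ n *m map_mx p g = map_mx p g *m map_mx p X.
Proof.
move=> p; pose s : {rmorphism A -> _} := p.
rewrite (map_coef_mx s) (map_rev_mx s).
apply: coef_mx_commute; [exact: (M_entry_sub s)|exact: (M_entry_low s)|].
apply: eps_eq0; [exact: (M_entry_sub s)|exact: (M_entry_low s)|].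
rewrite -(map_rev_mx s) -(map_e0 s) -(map_krylov s).
apply/rowP => j; rewrite [LHS]mxE [RHS]mxE; apply/eqP; rewrite proj_eq0.
exact: nilp_eq_in.
Qed.

(** The q_rs that are not next to the diagonal: without them X is tridiagonal. *)
Definition long : pred (qvar n) := fun t => ((val t).1.+1 < (val t).2)%N.

Lemma lead_minor_nzd_long (k : 'I_n) :
  nzd (nilp_idealr C long) (\det (lead k (rev_rows g))).
Proof.
set J := nilp_idealr C long; pose p : {rmorphism A -> {ideal_quot J}} := proj J.
have NgE : jordan _ n *m map_mx p g = map_mx p g *m map_mx p X := coef_mx_mod long.
have ug : lower_unip (map_mx p g).
  move=> i j le_ij; rewrite mxE.
  by rewrite coef_mx_unip // rmorph_nat.
have X0 (i j : 'I_n) : (j.+1 < i)%N -> map_mx p X i j = 0.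
  move=> lt_ji; rewrite mxE.
  have lt_rev : (rev_ord i < rev_ord j)%N by rewrite /=; have := ltn_ord i; lia.
  rewrite (revM_low C lt_rev) rmorphN; apply/eqP; rewrite oppr_eq0 [_ == _]proj_eq0.
  apply: nilp_var_in; rewrite /long /=; have := ltn_ord i; lia.
have nzd_sub (l : 'I_m) : nzd J (subdiag X l).
  have lt_rev : (rev_ord (lift ord0 l) < rev_ord (widen_ord (leqnSn m) l))%N.
    by rewrite /= /bump /=; have := ltn_ord l; lia.
  move=> f; rewrite /subdiag (revM_low C lt_rev) mulNr => fJ.
  apply: (@nilp_ideal_varI _ _ long (exist _ (_, _) lt_rev)); last first.
    by rewrite -rpredN.
  by rewrite /long /= /bump /= -leqNgt; have := ltn_ord l; lia.
have psub l : p (subdiag X l) = subdiag (map_mx p X) l by rewrite /subdiag [RHS]mxE.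
have pg i j : p (g i j) = map_mx p g i j by rewrite [RHS]mxE.
have p_corner : p (\adj g ord_max 0 * g ord_max 0) = p (\prod_l subdiag X l).
  rewrite rmorphM rmorph_prod (eq_bigr _ (fun l _ => psub l)).
  by rewrite -(corner_dvd ug NgE X0) -map_mx_adj pg [in RHS]mxE.
have nzd_corner : nzd J (g ord_max 0).
  by apply: nzd_dvd p_corner _; exact: nzd_prod.
have [e De] := lead_minor_dvd NgE X0 k.
have p_minor : p ((\prod_l subdiag X l ^+ e l) * \det (lead k (rev_rows g)))
    = p (g ord_max 0 ^+ k.+1).
  rewrite rmorphXn pg -De rmorphM mulrC -map_rev_rows -map_lead det_map_mx.
  congr (_ * _); rewrite rmorph_prod; apply: eq_bigr => l _.
  by rewrite rmorphXn psub.
by apply: nzd_dvd p_minor _; exact: nzd_exp.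
Qed.

Lemma lead_minor_nzd (V : pred (qvar n)) (k : 'I_n) : {subset V <= long} ->
  nzd (nilp_idealr C V) (\det (lead k (rev_rows g))).
Proof.
move=> sVl; apply: nilp_ideal_nzd sVl _; exact: lead_minor_nzd_long.
Qed.

End LeadingMinorsNzd.

(** * Transfer to the coordinates of the unipotent matrix *)

Section Transfer.
Variables (C : fieldType) (m : nat) (h : hess_fun m.+1).
Local Notation n := m.+1.
Local Notation gU := (gen_unip C n).
Local Notation X := (rev_mx (M_entry C m) m).
Local Notation g := (coef_mx (M_entry C m) m).

Definition coef_subst (v : xvar n) : {mpolyT C[xqvar n]} := g (val v).1 (val v).2.

Lemma map_coef_subst : map_mx (substT coef_subst) gU = g.
Proof.
apply/matrixP => i j; rewrite [LHS]mxE; case: (leqP i j) => [le_ij|lt_ji].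
  by rewrite gen_unip_lower // rmorph_nat coef_mx_unip.
by rewrite (gen_unip_xij _ lt_ji) substT_var.
Qed.

Lemma map_xq_conj_jordan : map_mx (substT (xq_value (conj_jordan C m))) X = conj_jordan C m.
Proof.
pose s : {rmorphism _ -> _} := substT (xq_value (conj_jordan C m)).
rewrite (map_rev_mx s); apply: xq_value_inj => [||v].
- exact: rev_mx_hess (M_entry_sub s) (M_entry_low s).
- exact: conj_jordan_hess.
by rewrite -rev_mx_xq /s /= substT_var.
Qed.

Lemma krylov_conj_jordan : krylov (e0 _ m) (conj_jordan C m) n = 0.
Proof.
have g0 : row 0 gU = e0 _ m.
  apply/rowP => j; rewrite [LHS]mxE gen_unip_lower // mxE eqxx eq_sym.
  by rewrite -!val_eqE.
by have [] := row_krylov (gen_unip_conj_jordan C m) g0.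
Qed.

Lemma subst_coef_substK f : substT (xq_value (conj_jordan C m)) (substT coef_subst f) = f.
Proof.
pose s : {rmorphism _ -> _} := substT (xq_value (conj_jordan C m)).
have NgE : jordan _ n *m gU = gU *m rev_mx (fun i j => s (M_entry C m i j)) m.
  by rewrite -(map_rev_mx s) map_xq_conj_jordan; exact: gen_unip_conj_jordan.
have [gE _] := coef_mx_uniq (M_entry_sub s) (M_entry_low s) (@gen_unip_lower C m) NgE.
rewrite -(map_coef_mx s) in gE.
suff : s \o substT coef_subst =1 idfun by apply.
apply: varT_hom_ext => [c|v]; first by rewrite /= !substT_C.
rewrite /= substT_var; move/matrixP: gE => /(_ (val v).1 (val v).2).
rewrite [LHS]mxE => ->; case: v => -[i j] lt_ji.
by rewrite (gen_unip_xij _ lt_ji).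
Qed.

Definition killed_q : pred (qvar n) := fun t => killed h (val t).

(** Indecomposability is exactly what keeps the q_rs next to the diagonal. *)
Lemma killed_long : indecomposable h -> {subset killed_q <= long (m := m)}.
Proof.
move=> indec [[r q] /= lt_rq]; rewrite /in_mem /= /killed_q /killed /long /= => kt.
have lt_qn := ltn_ord q; rewrite ltn_neqAle lt_rq andbT; apply/negP => /eqP eq_rq.
have lt_rev : (rev_ord q < n.-1)%N by rewrite /=; lia.
by have := indec _ lt_rev; rewrite /=; lia.
Qed.

Lemma idealZ_nilp f :
  (f \in idealZ C h) = (substT coef_subst f \in nilp_idealr C killed_q).
Proof.
apply/idP/idP => [|fJ].
  rewrite idealZE -proj_eq0 => fI; apply/eqP.
  pose p := proj (nilp_idealr C killed_q).
  pose t : {rmorphism _ -> _} := p \o substT coef_subst.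
  have tXG : map_mx t (conj_jordan C m) = map_mx p X.
    apply: hom_conj_jordan; rewrite map_mx_comp map_coef_subst; exact: coef_mx_mod.
  apply: (gen_ideal_hom (ev := t)) fI => -[i j]; rewrite /off_hess /= => lt_hji.
  transitivity (map_mx p X i j); first by rewrite -tXG [RHS]mxE.
  have lt_ji := leq_ltn_trans (hess_ge h j) lt_hji.
  have lt_rev : (rev_ord i < rev_ord j)%N by rewrite /=; have := ltn_ord i; lia.
  rewrite [LHS]mxE (revM_low C lt_rev); apply/eqP; rewrite [_ == _]proj_eq0 rpredN.
  apply: nilp_var_in; rewrite /killed_q.
  rewrite -[killed _ _]/(h (rev_ord (rev_ord j)) < rev_ord (rev_ord i))%N.
  by rewrite !rev_ordK.
pose s : {rmorphism _ -> _} := proj (idealZ C h) \o substT (xq_value (conj_jordan C m)).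
rewrite -[f]subst_coef_substK -proj_eq0; apply/eqP.
apply: (nilp_ideal_hom (V := killed_q) (s := s)) fJ => [|t kt].
  rewrite map_mx_comp map_xq_conj_jordan -(map_e0 (proj (idealZ C h))) -map_krylov.
  by rewrite krylov_conj_jordan map_mx0.
rewrite /s /= substT_var /= rmorphN; apply/eqP; rewrite oppr_eq0 [_ == _]proj_eq0.
rewrite idealZE.
exact: (@gen_ideal_gen _ _ (off_hess h) (fun p => conj_jordan C m p.1 p.2)
          (rev_ord (val t).1, rev_ord (val t).2)).
Qed.

Lemma lead_minor_idealZ (k : 'I_n) : indecomposable h ->
  nzd (idealZ C h) (\det (lead k (rev_rows gU))).
Proof.
move=> indec f; rewrite !idealZ_nilp rmorphM -det_map_mx /=.
rewrite map_lead map_rev_rows map_coef_subst.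
by apply: lead_minor_nzd; exact: killed_long.
Qed.

End Transfer.

(** * Polynomial identities and localization *)

Lemma digits_inj B N (u v : nat -> nat) :
    (forall i, (u i < B)%N) -> (forall i, (v i < B)%N) ->
    (\sum_(i < N) u i * B ^ i = \sum_(i < N) v i * B ^ i)%N ->
  forall i, (i < N)%N -> u i = v i.
Proof.
elim: N u v => [//|N IHN] u v uB vB.
have B_gt0 : (0 < B)%N by exact: leq_ltn_trans (uB 0%N).
have E (w : nat -> nat) : (\sum_(i < N.+1) w i * B ^ i
    = (\sum_(i < N) w i.+1 * B ^ i) * B + w 0)%N.
  rewrite big_ord_recl expn0 muln1 addnC; congr (_ + _)%N.
  by rewrite big_distrl; apply: eq_bigr => i _; rewrite /= /bump add1n expnSr mulnA.
rewrite !E => eq_uv.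
have eq0 : u 0%N = v 0%N.
  by have := congr1 (modn^~ B) eq_uv; rewrite !modnMDl !modn_small.
have eqS : (\sum_(i < N) u i.+1 * B ^ i = \sum_(i < N) v i.+1 * B ^ i)%N.
  have := congr1 (divn^~ B) eq_uv.
  by rewrite !divnMDl // !divn_small // !addn0.
case=> [//|i] lt_iN; exact: (IHN (fun i => u i.+1) (fun i => v i.+1)).
Qed.

(** Kronecker's substitution x_i := t^(B^i), with B larger than all exponents, reduces
    to polynomials in one variable. *)
Lemma mpoly_eval_eq0 (C : fieldType) N (p : {mpoly C[N]}) :
  [pchar C] =i pred0 -> (forall a, meval a p = 0) -> p = 0.
Proof.
move=> /pcharf0P char0 p0; pose B := msize p.
pose code (u : 'X_{1..N}) := (\sum_i u i * B ^ i)%N.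
pose q : {poly C} := \sum_(u <- msupp p) p@_u *: 'X^(code u).
have qE (t : C) : q.[t] = 0.
  rewrite -(p0 (fun i => t ^+ (B ^ i))) mevalE horner_sum.
  apply: eq_bigr => u _; rewrite hornerZ hornerXn /code -prodrXr; congr (_ * _).
  by apply: eq_bigr => i _; rewrite -exprM mulnC.
have q0 : q = 0.
  apply/eqP; apply: contraT => nz_q.
  have := @max_poly_roots C q [seq i%:R | i <- iota 0 (size q)] nz_q.
  rewrite size_map size_iota ltnn; apply.
    by apply/allP => x _; rewrite rootE qE.
  rewrite map_inj_in_uniq ?iota_uniq // => i j _ _ /eqP.
  wlog le_ij : i j / (i <= j)%N.
    by move=> W; case/orP: (leq_total i j) => /W // H; rewrite eq_sym => /H ->.
  rewrite eq_sym -subr_eq0 -natrB // char0 subn_eq0 => le_ji.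
  by apply/eqP; rewrite eqn_leq le_ij.
apply/mpolyP => u; rewrite mcoeff0.
case: (boolP (u \in msupp p)) => [up|]; last by rewrite mcoeff_msupp negbK => /eqP.
have := congr1 (fun r : {poly C} => r`_(code u)) q0; rewrite coef0 coef_sum.
rewrite (big_rem u) //= coefZ coefXn eqxx mulr1 big_seq big1 ?addr0 // => v vp.
have {vp} [ne_vu vp] : v != u /\ v \in msupp p.
  by move: vp; rewrite mem_rem_uniq ?msupp_uniq // inE => /andP[].
rewrite coefZ coefXn; case: eqP => [eq_code|_]; last by rewrite mulr0.
case/eqP: ne_vu; apply/mnmP => i.
have digit (w : 'X_{1..N}) : w \in msupp p -> forall j, (w j < B)%N.
  move=> /msize_mdeg_lt wp j; apply: leq_ltn_trans wp.
  by rewrite mdegE (bigD1 j) //= leq_addr.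
pose d (w : 'X_{1..N}) k := if insub k is Some j then w j else 0%N.
have dE (w : 'X_{1..N}) (j : 'I_N) : d w j = w j by rewrite /d valK.
have dB (w : 'X_{1..N}) : w \in msupp p -> forall k, (d w k < B)%N.
  move=> wp k; rewrite /d; case: insub => [j|]; first exact: digit.
  exact: leq_ltn_trans (leq0n _) (digit _ wp i).
rewrite -!dE; apply: (digits_inj (dB _ vp) (dB _ up)) (ltn_ord i).
under eq_bigr do rewrite dE; under [RHS]eq_bigr do rewrite dE.
exact/esym.
Qed.

Section Localization.
Variables (Q : comNzRingType) (D : Q).
Hypothesis D_nzd : forall z, D * z = 0 -> z = 0.

(** The localization at D is Q[X] / (1 - D X). *)
Definition loc_ideal : pred {poly Q} :=
  fun p => `[< exists s, p = s * (1 - D *: 'X) >].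

(** If c = s (1 - D X), then the coefficients of s are c, D c, D^2 c, ..., so that a
    power of D kills c. *)
Lemma loc_ideal_const c : c%:P \in loc_ideal -> c = 0.
Proof.
move=> /asboolP[s /polyP cE].
have sE k : s`_k = D ^+ k * c.
  elim: k => [|k IHk].
    have := cE 0%N; rewrite coefC mulrBr mulr1 -scalerAr coefB coefZ coefMX mulr0.
    by rewrite subr0 expr0 mul1r.
  have := cE k.+1; rewrite coefC mulrBr mulr1 -scalerAr coefB coefZ coefMX /=.
  by move/esym/eqP; rewrite subr_eq0 IHk exprS mulrA => /eqP.
have := sE (size s); rewrite nth_default //.
by elim: (size s) => [|k IHk]; rewrite ?expr0 ?mul1r // exprS -mulrA => /esym/D_nzd/esym.
Qed.

Lemma loc_ideal_closed : idealr_closed loc_ideal.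
Proof.
split.
- by apply/asboolP; exists 0; rewrite mul0r.
- by apply/negP => /loc_ideal_const/eqP; rewrite oner_eq0.
- move=> a u v /asboolP[s ->] /asboolP[t ->]; apply/asboolP.
  by exists (a * s + t); rewrite mulrDl mulrA.
Qed.
HB.instance Definition _ := isIdealr.Build {poly Q} loc_ideal loc_ideal_closed.
Definition loc_idealr : idealr {poly Q} := loc_ideal.

Lemma localization : exists (S : comNzRingType) (io : {rmorphism Q -> S}),
  injective io /\ exists e, io D * e = 1.
Proof.
pose p : {rmorphism {poly Q} -> {ideal_quot loc_idealr}} := proj loc_idealr.
pose io : {rmorphism Q -> {ideal_quot loc_idealr}} := p \o polyC.
exists {ideal_quot loc_idealr}, io; split.
  apply: raddf_inj => c /eqP; rewrite [_ == _]proj_eq0.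
  exact: loc_ideal_const.
exists (p 'X); have p0 : p (1 - D *: 'X) = 0.
  apply/eqP; rewrite [_ == _]proj_eq0; apply/asboolP.
  by exists 1; rewrite mul1r.
by apply/esym/eqP; rewrite -subr_eq0 -p0 rmorphB rmorph1 -mul_polyC rmorphM.
Qed.
End Localization.

(** The value of f at the fractions num_i / del, times a power of del, is a polynomial
    f' in the numerators, and this holds uniformly over all rings in which del becomes
    invertible. *)
Lemma clear_denominators (C : comNzRingType) n (R : comNzRingType)
    (ka : {rmorphism C -> R}) (num : 'I_n -> R) (del : R) (f : {mpoly C[n]}) :
  exists (k : nat) (f' : R), forall (L : comNzRingType) (ev : {rmorphism R -> L}) e,
    ev del * e = 1 ->
    ev f' = ev del ^+ k * mmap (ev \o ka) (fun i => e * ev (num i)) f.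
Proof.
elim/mpolyind: f => [|c u p _ _ [k [f' fE]]].
  by exists 0%N, 0 => L ev e _; rewrite rmorph0 [mmap _ _ _]rmorph0 mulr0.
pose d := mdeg u.
exists (k + d)%N, (del ^+ d * f' + del ^+ k * (ka c * \prod_i num i ^+ u i)).
move=> L ev e del_e; rewrite rmorphD /= 3!rmorphM /= (fE L ev e del_e) !rmorphXn.
rewrite raddfD /= mmapZ mmapX /=.
have -> : mmap1 (fun i => e * ev (num i)) u = e ^+ d * \prod_i ev (num i) ^+ u i.
  rewrite /mmap1 /d mdegE -prodrXr -big_split /=.
  by apply: eq_bigr => i _; rewrite exprMn.
have -> : ev (\prod_i num i ^+ u i) = \prod_i ev (num i) ^+ u i.
  by rewrite rmorph_prod; apply: eq_bigr => i _; rewrite rmorphXn.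
have ed : ev del ^+ d * e ^+ d = 1 by rewrite -exprMn del_e expr1n.
set P := \prod_i _; set M := mmap _ _ _.
rewrite mulrDr addrC exprD; congr (_ + _); last by ring.
rewrite -[LHS]mul1r -ed; ring.
Qed.

(** * Triangular factorization *)

Section Triangular.
Variables (L : comNzRingType) (n : nat).
Implicit Types (A U V g : 'M[L]_n) (e : 'I_n -> L).

Lemma lead_adj_sum A (i j : 'I_n) : (i <= j)%N ->
  \sum_(k < n | (k <= j)%N) A i k * \adj (lead j A) (inord k) ord_max
    = \det (lead j A) *+ (i == j).
Proof.
move=> le_ij; have lt_ij : (i < j.+1)%N by [].
have /matrixP/(_ (Ordinal lt_ij) ord_max) := mul_mx_adj (lead j A).
rewrite [LHS]mxE [X in _ = X -> _]mxE -val_eqE /= => <-.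
rewrite (big_ord_narrow_cond (P := xpredT) (ltn_ord j)); apply: eq_bigr => k _.
rewrite [X in _ = X * _]mxE; congr (A _ _ * _); first exact: val_inj.
by congr (fun_of_matrix (\adj _) _ _); apply: val_inj; rewrite /= inordK.
Qed.

(** Column j solves the linear system given by the leading block of size j + 1, with
    right hand side e_j times the determinant of the block times the last unit vector.
    So A times this matrix is lower triangular; it is unipotent if the e_j are the
    inverses of the leading minors, while for e = 1 there are no denominators. *)
Definition lead_inv e A : 'M[L]_n :=
  \matrix_(i, j) if (i <= j)%N then e j * \adj (lead j A) (inord i) ord_max else 0.

Lemma lead_inv_upper e A : upper_tri (lead_inv e A).
Proof. by move=> i j lt_ji; rewrite mxE leqNgt lt_ji. Qed.

Lemma mul_lead_invE e A i j :
  (A *m lead_inv e A) i j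
    = e j * \sum_(k < n | (k <= j)%N) A i k * \adj (lead j A) (inord k) ord_max.
Proof.
rewrite mxE [in RHS]big_mkcond mulr_sumr; apply: eq_bigr => k _.
by rewrite mxE; case: ifP; rewrite ?mulr0 // mulrCA.
Qed.

Lemma mul_lead_inv_unip e A : (forall j, \det (lead j A) * e j = 1) ->
  lower_unip (A *m lead_inv e A).
Proof.
move=> eA i j le_ij; rewrite mul_lead_invE lead_adj_sum // mulrC.
by case: eqP => _; rewrite ?mulr1n ?eA // mulr0n mul0r.
Qed.

Lemma upper_mul U V : upper_tri U -> upper_tri V -> upper_tri (U *m V).
Proof.
move=> upU upV i j lt_ji; rewrite mxE big1 // => k _.
case: (ltnP k i) => [lt_ki|le_ik]; first by rewrite upU ?mul0r.
by rewrite upV ?mulr0 //; exact: leq_trans le_ik.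
Qed.

Lemma upper_diag_inv U V : upper_tri U -> V *m U = 1%:M ->
  exists e, forall i, U i i * e i = 1.
Proof.
move=> upU VU; exists (fun i => \prod_(k | k != i) U k k * \det V) => i.
have : \det V * \det U = 1 by rewrite -det_mulmx VU det1.
have -> : \det U = \prod_k U k k.
  rewrite -det_tr det_trig; first by apply: eq_bigr => k _; rewrite mxE.
  by apply/is_trig_mxP => k l lt_kl; rewrite mxE upU.
by rewrite (bigD1 i) //= mulrC mulrA.
Qed.

Lemma upper_inv U V : upper_tri U -> V *m U = 1%:M -> upper_tri V.
Proof.
move=> upU VU; have [e eU] := upper_diag_inv upU VU => i [j lt_jn] /=.
elim/ltn_ind: j lt_jn => j IHj lt_jn lt_ji; set j' := Ordinal lt_jn.
have : (V *m U) i j' = 0 by rewrite VU mxE -val_eqE /= gtn_eqF.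
rewrite mxE (bigD1 j') //= big1 ?addr0 => [|k ne_kj].
  by move/(congr1 ( *%R^~ (e j'))); rewrite -mulrA eU mulr1 mul0r.
case: (ltngtP k j) => [lt_kj|lt_jk|ekj].
- have -> : k = Ordinal (ltn_ord k) by apply: val_inj.
  by rewrite IHj ?mul0r //; exact: ltn_trans lt_ji.
- by rewrite upU ?mulr0.
by rewrite -val_eqE /= ekj eqxx in ne_kj.
Qed.

(** Uniqueness of the triangular factorization. *)
Lemma lower_unip_mul_upper g U : lower_unip g -> upper_tri U ->
  lower_unip (g *m U) -> g *m U = g.
Proof.
move=> ug upU ugU; suff -> : U = 1%:M by rewrite mulmx1.
apply/matrixP => i j; rewrite [RHS]mxE.
case: (leqP i j) => [|lt_ji]; last by rewrite upU // -val_eqE /= gtn_eqF.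
case: i => i lt_in; elim/ltn_ind: i lt_in => i IHi lt_in /= le_ij.
set i' := Ordinal lt_in; rewrite -(ugU i' j le_ij) mxE (bigD1 i') //=.
rewrite ug // eqxx mul1r big1 ?addr0 // => k ne_ki.
case: (ltnP i' k) => [lt_ik|le_ki].
  by rewrite ug 1?ltnW // eq_sym (negPf ne_ki) mul0r.
have lt_ki : (k < i)%N by rewrite ltn_neqAle le_ki andbT; rewrite -val_eqE in ne_ki.
have -> : k = Ordinal (ltn_ord k) by apply: val_inj.
have lt_kj := leq_trans lt_ki le_ij.
by rewrite IHi ?(ltnW lt_kj) // -val_eqE /= ltn_eqF ?mulr0.
Qed.

Lemma lower_unip_lead g k : lower_unip g -> \det (lead k g) = 1.
Proof.
move=> ug; rewrite det_lead_trig ?lower_unip_trig // big1 // => i _.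
by rewrite ug // eqxx.
Qed.

Lemma lead_inv_scale e A i j :
  (A *m lead_inv e A) i j = e j * (A *m lead_inv (fun=> 1) A) i j.
Proof. by rewrite !mul_lead_invE mul1r. Qed.

End Triangular.

Lemma map_lead_inv (L L' : comNzRingType) n (s : {rmorphism L -> L'})
    (e : 'I_n -> L) (A : 'M[L]_n) :
  map_mx s (lead_inv e A) = lead_inv (fun j => s (e j)) (map_mx s A).
Proof.
apply/matrixP => i j; rewrite [LHS]mxE [X in s X]mxE [RHS]mxE.
case: ifP => _; last exact: rmorph0.
by rewrite rmorphM -map_lead -map_mx_adj [in RHS]mxE.
Qed.


(** * Free coordinates on the open cell *)

Section Shift.
Variables (L : comNzRingType) (m : nat).
Local Notation n := m.+1.
Implicit Types (Y v : 'M[L]_n) (l : 'rV[L]_n).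

Definition shift_lower Y : Prop :=
  forall i j : 'I_n, (i <= j.+1)%N -> Y i j = (i == j.+1 :> nat)%:R.

Definition krylov_mx l Y : 'M[L]_n := \matrix_(i, j) krylov l Y i 0 j.

Lemma krylov_shift l Y k (j : 'I_n) : shift_lower Y -> l 0 ord_max = 1 ->
  (m <= k + j)%N -> krylov l Y k 0 j = (k + j == m)%:R.
Proof.
move=> sY l1; elim: k j => [|k IHk] j le_m.
  have -> : j = ord_max by apply: val_inj; apply/eqP; rewrite eqn_leq le_m -ltnS ltn_ord.
  by rewrite /= l1 eqxx.
rewrite /krylov iterS -/(krylov l Y k) mxE.
case: (ltnP j.+1 n) => [lt_j1|le_nj].
  rewrite (bigD1 (Ordinal lt_j1)) //= sY //= eqxx mulr1 IHk /= ?addnS //.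
  rewrite big1 => [|i ne_i]; first by rewrite addr0; congr (nat_of_bool _)%:R; lia.
  case: (leqP i j.+1) => [le_ij|lt_ji].
    by rewrite sY // -[i == _ :> nat]/(i == Ordinal lt_j1) (negPf ne_i) mulr0.
  by rewrite IHk; [rewrite gtn_eqF ?mul0r //; lia | lia].
have -> : (k.+1 + j == m) = false by apply/negbTE; lia.
by rewrite big1 // => i _; have lt_in := ltn_ord i; rewrite sY ?ltn_eqF ?mulr0 //; lia.
Qed.

Lemma krylov_mx_jordan l Y : shift_lower Y -> l 0 ord_max = 1 ->
  jordan L n *m krylov_mx l Y = krylov_mx l Y *m Y.
Proof.
move=> sY l1; apply: (krylov_row (l := l)) => [i|].
  by apply/rowP => j; rewrite !mxE.
apply/rowP => j; rewrite (krylov_shift sY l1); last by lia.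
by rewrite mxE gtn_eqF //; lia.
Qed.

(** Up to the order of the rows of v, N moves the rows down; the claim is the
    recursion of [lower_hess_conj] read in this order. *)
Lemma jordan_shift v Y : lower_unip (rev_rows v) -> jordan L n *m v = v *m Y ->
  shift_lower Y.
Proof.
move=> uv NvE.
have revE (i j : 'I_n) : (rev_rows v *m Y) i j
    = if insub (rev_ord i).+1 is Some k then v k j else 0.
  by rewrite -rev_rows_mul mxE -NvE jordan_mulE.
move=> [i lt_in] j; elim/ltn_ind: i lt_in => i IHi lt_in /= le_ij.
set i' := Ordinal lt_in.
have : (rev_rows v *m Y) i' j = (i == j.+1)%:R.
  rewrite revE; case: insubP => [k _ ek|].
    have i_gt0 : (0 < i)%N by have := ltn_ord k; rewrite ek /=; lia.
    have -> : v k j = rev_rows v (rev_ord k) j by rewrite mxE rev_ordK.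
    rewrite uv; last by rewrite /= ek /=; lia.
    by congr (nat_of_bool _)%:R; rewrite -val_eqE /= ek /=; lia.
  rewrite -leqNgt /= => le_n; have -> : i = 0%N by lia.
  by [].
rewrite mxE (bigD1 i') //= uv // eqxx mul1r big1 ?addr0 // => k ne_ki.
case: (ltnP i' k) => [lt_ik|le_ki].
  by rewrite uv 1?ltnW // eq_sym (negPf ne_ki) mul0r.
have lt_ki : (k < i)%N by rewrite ltn_neqAle le_ki andbT; rewrite -val_eqE in ne_ki.
have -> : k = Ordinal (ltn_ord k) by apply: val_inj.
rewrite IHi //=; last by apply: leq_trans le_ij; exact: ltnW.
by rewrite ltn_eqF ?mulr0 //; exact: leq_trans lt_ki le_ij.
Qed.

End Shift.

Section HessPattern.
Variables (n : nat) (h : hess_fun n).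

Definition hess_pat (L : comNzRingType) (X : 'M[L]_n) : Prop :=
  forall i j : 'I_n, (h j < i)%N -> X i j = 0.

(** The Hessenberg shape only depends on the flag, not on the basis adapted to it. *)
Lemma hess_pat_conj (L : comNzRingType) (U X V : 'M[L]_n) :
  upper_tri U -> hess_pat X -> upper_tri V -> hess_pat (U *m X *m V).
Proof.
move=> upU hX upV i j lt_hji; rewrite mxE big1 // => k _.
case: (ltnP j k) => [lt_jk|le_kj]; first by rewrite upV ?mulr0.
rewrite mxE big1 ?mul0r // => l _.
case: (ltnP l i) => [lt_li|le_il]; first by rewrite upU ?mul0r.
rewrite hX ?mulr0 //; apply: leq_trans le_il.
by apply: leq_ltn_trans lt_hji; exact: hess_mono.
Qed.
End HessPattern.

Section CyclicCoordinates.
Variables (m : nat) (h : hess_fun m.+1).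
Local Notation n := m.+1.
Definition par : finType := ('I_n + 'I_n * 'I_n)%type.

Definition par_mx (L : comNzRingType) (y : par -> L) : 'M[L]_n :=
  \matrix_(i, j) if (i <= j.+1)%N then (i == j.+1 :> nat)%:R
                 else if (i <= h j)%N then y (inr (i, j)) else 0.

Definition par_row (L : comNzRingType) (y : par -> L) : 'rV[L]_n :=
  \row_j (if j == ord_max then 1 else y (inl j)).

Definition par_flag (L : comNzRingType) (y : par -> L) : 'M[L]_n :=
  krylov_mx (par_row y) (par_mx y).

Lemma par_mx_shift (L : comNzRingType) (y : par -> L) : shift_lower (par_mx y).
Proof. by move=> i j le_ij; rewrite mxE le_ij. Qed.

Lemma par_mx_pat (L : comNzRingType) (y : par -> L) :
  indecomposable h -> hess_pat h (par_mx y).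
Proof.
move=> indec i j lt_hji; rewrite mxE leqNgt.
have lt_j1 : (j.+1 < i)%N.
  exact: leq_ltn_trans (indec j (hess_last lt_hji)) lt_hji.
by rewrite lt_j1 leqNgt lt_hji.
Qed.

Lemma par_flag_jordan (L : comNzRingType) (y : par -> L) :
  jordan L n *m par_flag y = par_flag y *m par_mx y.
Proof.
by apply: krylov_mx_jordan; [exact: par_mx_shift | rewrite mxE eqxx].
Qed.

Lemma map_par_flag (L L' : comNzRingType) (s : {rmorphism L -> L'}) (y : par -> L) :
  map_mx s (par_flag y) = par_flag (fun t => s (y t)).
Proof.
have rE : map_mx s (par_row y) = par_row (fun t => s (y t)).
  by apply/rowP => j; rewrite !mxE; case: ifP; rewrite ?rmorph1.
have mE : map_mx s (par_mx y) = par_mx (fun t => s (y t)).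
  by apply/matrixP => i j; rewrite !mxE; do 2?case: ifP; rewrite ?rmorph_nat ?rmorph0.
by apply/matrixP => i j; rewrite [RHS]mxE -rE -mE -map_krylov !mxE.
Qed.

(** The matrices v with rows l Y^i are all the solutions: the first row of v and the
    matrix Y can be read off. *)
Lemma par_flag_surj (L : comNzRingType) (v Y : 'M[L]_n) :
    lower_unip (rev_rows v) -> hess_pat h Y -> jordan L n *m v = v *m Y ->
  exists y : par -> L, par_flag y = v.
Proof.
move=> uv hY NvE; have sY := jordan_shift uv NvE.
exists (fun t => match t with inl j => v 0 j | inr p => Y p.1 p.2 end).
set y := fun t => _.
have rE : par_row y = row 0 v.
  apply/rowP => j; rewrite !mxE; case: eqP => // ->.
  have := uv ord_max ord_max (leqnn _); rewrite eqxx mxE => v1.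
  by rewrite -[LHS]v1; congr (v _ _); apply: val_inj; rewrite /= subnn.
have mE : par_mx y = Y.
  apply/matrixP => i j; rewrite mxE; case: leqP => [le_ij|_]; first by rewrite sY.
  by case: leqP => // /hY.
rewrite -{}mE in NvE; apply/row_matrixP => i.
have [-> _] := row_krylov NvE (esym rE).
by apply/rowP => j; rewrite [LHS]mxE [LHS]mxE.
Qed.

End CyclicCoordinates.

(** * Points of the Hessenberg variety *)

Section UnipCoordinates.
Variables (L : comNzRingType) (n : nat).

Lemma unip_lower (a : xvar n -> L) : lower_unip (unip a).
Proof. by move=> i j le_ij; rewrite mxE insubF //= ltnNge le_ij. Qed.

Lemma unip_coord (g : 'M[L]_n) : lower_unip g ->
  unip (fun t : xvar n => g (val t).1 (val t).2) = g.
Proof.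
move=> ug; apply/matrixP => i j; rewrite mxE.
case: insubP => [t _ -> //|]; rewrite -leqNgt => /= le_ij.
by rewrite ug.
Qed.
End UnipCoordinates.

Section HessenbergPoints.
Variables (C : fieldType) (m : nat) (h : hess_fun m.+1).
Local Notation n := m.+1.
Implicit Types (g X : 'M[C]_n).

Lemma lower_unip_unit g : lower_unip g -> g \in unitmx.
Proof. by move=> ug; rewrite unitmxE det_lower_unip ?unitr1. Qed.

Lemma Hess_point g X (a : xvar n -> C) f : f \in idealHess C h ->
  lower_unip g -> jordan C n *m g = g *m X -> hess_pat h X -> unip a = g ->
  evalT a f = 0.
Proof.
move=> /asboolP fI ug NgE hX aE.
have nest (i j : 'I_n) : (i <= j)%N -> (span_cols g i <= span_cols g j)%VS.
  move=> le_ij; apply: sub_span => _ /mapP[k + ->].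
  rewrite mem_filter => /andP[le_ki k_in]; apply: map_f.
  by rewrite mem_filter (leq_trans le_ki).
pose V := Flag (fun j => dim_span_cols j (lower_unip_unit ug)) nest.
apply: (fI V); last by move=> j; rewrite aE.
- move=> i v vV.
  pose N : 'Hom('cV[C]_n, 'cV[C]_n) := linfun (mulmx (jordan C n)).
  have -> : jordan C n *m v = N v by rewrite lfunE.
  apply: (subvP _ _ (memv_img N vV)); rewrite /= /span_cols limg_span.
  apply/span_subvP => _ /mapP[_ /mapP[k + ->] ->].
  rewrite mem_filter => /andP[le_ki _]; rewrite lfunE /=.
  have -> : jordan C n *m col k g = \sum_l X l k *: col l g.
    rewrite colE mulmxA NgE -mulmxA -colE; apply/matrixP => r s.
    by rewrite !mxE summxE; apply: eq_bigr => l _; rewrite !mxE mulrC.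
  apply: memv_suml => l _; case: (ltnP (h i) l) => [lt_hil|le_lhi].
    rewrite hX ?scale0r ?mem0v //; apply: leq_ltn_trans lt_hil.
    exact: hess_mono.
  apply/memvZ/memv_span/map_f; by rewrite mem_filter le_lhi mem_enum.
by exists g; split=> //; [exact: lower_unip_trig | exact: lower_unip_unit].
Qed.

Lemma idealZ_sub_Hess f : f \in idealZ C h -> f \in idealHess C h.
Proof.
rewrite idealZE => fZ; apply/asboolP => V HV _ a aV.
apply: (gen_ideal_hom (ev := evalT a)) fZ => -[i j]; rewrite /off_hess /= => lt_hji.
pose g := unip a; have ug : g \in unitmx by apply/lower_unip_unit/unip_lower.
have -> : evalT a (conj_jordan C m i j) = (invmx g *m (jordan C n *m g)) i j.
  have NgE : jordan C n *m map_mx (evalT a) (gen_unip C n)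
      = map_mx (evalT a) (gen_unip C n) *m (invmx g *m (jordan C n *m g)).
    by rewrite map_gen_unip mulKVmx.
  by rewrite -(hom_conj_jordan NgE) [RHS]mxE.
have : jordan C n *m col j g \in V (h j).
  apply: HV; rewrite aV; apply/memv_span/map_f.
  by rewrite mem_filter leqnn mem_enum.
rewrite aV.
pose r : 'Hom('cV[C]_n, 'M[C]_1) := linfun (mulmx (row i (invmx g))).
suff sub : (span_cols g (h j) <= lker r)%VS.
  move/(subvP sub); rewrite memv_ker lfunE /= => /eqP/matrixP/(_ 0 0).
  have -> : row i (invmx g) *m (jordan C n *m col j g)
      = col j (row i (invmx g *m (jordan C n *m g))).
    by rewrite !colE row_mul !mulmxA.
  by rewrite mxE mxE [RHS]mxE.
apply/span_subvP => _ /mapP[k + ->]; rewrite mem_filter => /andP[le_k _].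
rewrite memv_ker lfunE /= colE mulmxA -row_mul mulVmx //.
apply/eqP/matrixP => x y; rewrite -colE !mxE -val_eqE /= gtn_eqF //.
exact: leq_ltn_trans lt_hji.
Qed.

End HessenbergPoints.

Section Parametrization.
Variables (C : fieldType) (m : nat) (h : hess_fun m.+1).
Local Notation n := m.+1.
Local Notation P := {mpolyT C[par m]}.

Definition gen_flag : 'M[P]_n := par_flag h (@varT C (par m)).

Definition minor_prod : P := \prod_k \det (lead k gen_flag).

(** The triangular factorization of [gen_flag] has the lower unipotent factor with
    entries [coord_num] / [minor_prod]: entry (i, j) only has the j-th minor as
    denominator, hence the product of the other minors in the numerator. *)
Definition coord_num (t : xvar n) : P :=
  (gen_flag *m lead_inv (fun=> 1) gen_flag) (val t).1 (val t).2
    * \prod_(k | k != (val t).2) \det (lead k gen_flag).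

Lemma coord_numE (L : comNzRingType) (ev : {rmorphism P -> L}) e :
    ev minor_prod * e = 1 ->
  exists2 e' : 'I_n -> L,
    forall k, \det (lead k (map_mx ev gen_flag)) * e' k = 1 &
    forall t, e * ev (coord_num t)
      = (map_mx ev gen_flag *m lead_inv e' (map_mx ev gen_flag)) (val t).1 (val t).2.
Proof.
move=> ev_e; pose v := map_mx ev gen_flag.
have detE k : ev (\det (lead k gen_flag)) = \det (lead k v).
  by rewrite -det_map_mx map_lead.
exists (fun j => e * \prod_(k | k != j) \det (lead k v)) => [k|t].
  rewrite -[RHS]ev_e mulrCA mulrC; congr (_ * _).
  rewrite /minor_prod rmorph_prod [RHS](bigD1 k) //= detE; congr (_ * _).
  by apply: eq_bigr => l _; rewrite detE.
rewrite [RHS]lead_inv_scale -/v -mulrA; congr (_ * _).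
rewrite /coord_num rmorphM rmorph_prod mulrC; congr (_ * _).
  by apply: eq_bigr => k _; rewrite detE.
have -> : v *m lead_inv (fun=> 1) v = map_mx ev (gen_flag *m lead_inv (fun=> 1) gen_flag).
  rewrite map_mxM map_lead_inv; congr (_ *m _); apply/matrixP => i j.
  by rewrite !mxE rmorph1.
by rewrite [RHS]mxE.
Qed.

(** Where the denominators do not vanish, the parameters give a flag in Hess(N, h) and
    in Omega_e, at which f is zero; elsewhere [minor_prod] is zero. *)
Lemma par_vanish f k (f' : P) : indecomposable h -> [pchar C] =i pred0 ->
    f \in idealHess C h ->
    (forall (L : comNzRingType) (ev : {rmorphism P -> L}) e,
      ev minor_prod * e = 1 ->
      ev f' = ev minor_prod ^+ k
        * mmap (ev \o @mpolyC _ C) (fun i => e * ev (coord_num (enum_val i))) f) ->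
  f' * minor_prod = 0.
Proof.
move=> indec char0 fI fE; apply: (mpoly_eval_eq0 char0) => a.
pose ev : {rmorphism P -> C} := meval a; rewrite -[meval a]/(ev : P -> C).
rewrite rmorphM; case: (eqVneq (ev minor_prod) 0) => [->|nz]; first by rewrite mulr0.
have ev_e : ev minor_prod * (ev minor_prod)^-1 = 1 by rewrite mulfV.
rewrite (fE _ ev _ ev_e); have [e' e'E numE] := coord_numE ev_e.
set e := _^-1 in numE *; set v := map_mx ev gen_flag in numE e'E.
pose b := lead_inv e' v; pose g := v *m b.
have ug : lower_unip g by exact: mul_lead_inv_unip.
pose t := fun u => e * ev (coord_num u).
have tg : unip t = g.
  rewrite -[RHS](unip_coord ug); congr unip; apply/funext => u; exact: numE.
suff -> : mmap (ev \o @mpolyC _ C) (fun i => e * ev (coord_num (enum_val i))) f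
    = evalT t f.
  have NvE : jordan C n *m v = v *m map_mx ev (par_mx h (@varT C (par m))).
    by rewrite -map_mxM -par_flag_jordan map_mxM map_jordan.
  have [b' b'b] : exists b', b' *m b = 1%:M.
    by exists (\adj g *m v); rewrite -mulmxA lower_unip_adj.
  have bb' := mulmx1C b'b.
  pose Y := map_mx ev (par_mx h (@varT C (par m))).
  rewrite (@Hess_point _ _ h g (b' *m Y *m b) t) ?mulr0 ?mul0r //.
    rewrite /g mulmxA NvE -/Y -!mulmxA; congr (_ *m _).
    by rewrite (mulmxA b) bb' mul1mx.
  apply: hess_pat_conj; last exact: lead_inv_upper.
    apply: upper_inv b'b; exact: lead_inv_upper.
  by move=> i j lt_hji; rewrite mxE par_mx_pat // rmorph0.
pose s1 : {rmorphism {mpolyT C[xvar n]} -> C} :=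
  mmap (ev \o @mpolyC _ C) (fun i : 'I_#|xvar n| => e * ev (coord_num (enum_val i))).
suff : s1 =1 evalT t by apply.
apply: varT_hom_ext => [c|u].
  by rewrite /s1 /= mmapC /= /ev /= /evalT !mevalC.
by rewrite /s1 /= /evalT /varT mmapX mmap1U mevalXU !enum_rankK.
Qed.

End Parametrization.

(** * The ideal of the equations is the vanishing ideal *)

Section Reducedness.
Variables (C : fieldType) (m : nat) (h : hess_fun m.+1).
Local Notation n := m.+1.
Local Notation P := {mpolyT C[par m]}.
Local Notation gU := (gen_unip C n).

(** Triangular factorization of g with its rows reversed: g b = v has reversed rows
    forming a lower unipotent matrix, hence comes from parameters. *)
Lemma hess_flag_param (L : comNzRingType) (g X : 'M[L]_n) d :
    lower_unip g -> jordan L n *m g = g *m X -> hess_pat h X ->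
    (\prod_k \det (lead k (rev_rows g))) * d = 1 ->
  exists (y : par m -> L) (b : 'M[L]_n) (e : 'I_n -> L),
    [/\ par_flag h y = g *m b, upper_tri b & forall i, b i i * e i = 1].
Proof.
move=> ug NgE hX Dd.
pose A := rev_rows g.
pose eA k := d * \prod_(l | l != k) \det (lead l A).
have eAE k : \det (lead k A) * eA k = 1.
  by rewrite /eA mulrCA mulrC -[RHS]Dd [in RHS](bigD1 k).
pose b := lead_inv eA A.
have ub : upper_tri b by exact: lead_inv_upper.
have uL : lower_unip (rev_rows (g *m b)).
  by rewrite rev_rows_mul; exact: mul_lead_inv_unip.
have [b' b'b] : exists b', b' *m b = 1%:M.
  exists (\adj (rev_rows (g *m b)) *m A).
  by rewrite -mulmxA -rev_rows_mul lower_unip_adj.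
have bb' := mulmx1C b'b.
have NvE : jordan L n *m (g *m b) = (g *m b) *m (b' *m X *m b).
  by rewrite mulmxA NgE -!mulmxA (mulmxA b) bb' mul1mx.
have hY : hess_pat h (b' *m X *m b).
  by apply: hess_pat_conj => //; exact: upper_inv b'b.
have [y yE] := par_flag_surj uL hY NvE.
have [e eE] := upper_diag_inv ub b'b.
by exists y, b, e.
Qed.

(** Take for g the universal solution over the localization S of the quotient by
    [idealZ] at D, find its parameters in S, and specialize the polynomial identity of
    [par_vanish] to them. *)
Lemma idealHess_sub_Z f : indecomposable h -> [pchar C] =i pred0 ->
  f \in idealHess C h -> f \in idealZ C h.
Proof.
move=> indec char0 fI.
pose Q := {ideal_quot idealZ C h}.
pose p : {rmorphism {mpolyT C[xvar n]} -> Q} := proj (idealZ C h).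
pose D := \prod_k \det (lead k (rev_rows gU)).
have D_nzd : nzd (idealZ C h) D.
  by apply: nzd_prod => k _; exact: lead_minor_idealZ.
have pD_nzd (z : Q) : p D * z = 0 -> z = 0.
  have [q ->] := proj_surj z; rewrite -[proj _ q]/(p q) -rmorphM => /eqP.
  by rewrite [_ == _]proj_eq0 => /D_nzd; rewrite -proj_eq0 => /eqP.
have [S [io [io_inj [d Dd]]]] := localization pD_nzd.
pose q : {rmorphism {mpolyT C[xvar n]} -> S} := io \o p.
suff qf0 : q f = 0.
  by rewrite -proj_eq0; apply/eqP/io_inj; rewrite [LHS]qf0 rmorph0.
pose g := map_mx q gU; pose X := map_mx q (conj_jordan C m).
have ug : lower_unip g by move=> i j le_ij; rewrite mxE gen_unip_lower // rmorph_nat.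
have NgE : jordan S n *m g = g *m X.
  by rewrite -map_mxM -gen_unip_conj_jordan map_mxM map_jordan.
have hX : hess_pat h X.
  move=> i j lt_hji; rewrite mxE.
  suff p0 : p (conj_jordan C m i j) = 0 by rewrite /q /= p0 rmorph0.
  apply/eqP; rewrite [_ == _]proj_eq0 idealZE.
  exact: (@gen_ideal_gen _ _ (off_hess h) (fun p => conj_jordan C m p.1 p.2) (i, j)).
have gd : (\prod_k \det (lead k (rev_rows g))) * d = 1.
  rewrite -[RHS]Dd -[io (p D)]/(q D) rmorph_prod; congr (_ * _); apply: eq_bigr => k _.
  by rewrite -map_rev_rows -map_lead det_map_mx.
have [y [b [e [yE ub be]]]] := hess_flag_param ug NgE hX gd.
pose ka : {rmorphism C -> S} := q \o @mpolyC _ C.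
pose ev : {rmorphism P -> S} := mmap ka (fun i : 'I_#|par m| => y (enum_val i)).
have evX t : ev (varT C t) = y t by rewrite /ev /= /varT mmapX mmap1U enum_rankK.
have evC c : ev c%:MP = q c%:MP by rewrite /ev /= mmapC.
have evE : map_mx ev (gen_flag C h) = g *m b.
  rewrite map_par_flag -yE; congr par_flag; apply/funext => t; exact: evX.
have leadE k : \det (lead k (g *m b))
    = \prod_(i < k.+1) b (widen_ord (ltn_ord k) i) (widen_ord (ltn_ord k) i).
  by rewrite lead_mul_upper // det_mulmx lower_unip_lead // mul1r det_lead_upper.
have [w ev_w] : exists w, ev (minor_prod C h) * w = 1.
  exists (\prod_(k : 'I_n) \prod_(i < k.+1) e (widen_ord (ltn_ord k) i)).
  rewrite /minor_prod rmorph_prod -big_split /= big1 // => k _.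
  have -> : ev (\det (lead k (gen_flag C h))) = \det (lead k (g *m b)).
    by rewrite -evE -map_lead det_map_mx.
  by rewrite leadE -big_split big1 // => i _; exact: be.
have [k [f' fE]] := clear_denominators (@mpolyC _ C)
  (fun i => coord_num C h (enum_val i)) (minor_prod C h) f.
have := par_vanish indec char0 fI fE.
move/(congr1 ev); rewrite rmorphM rmorph0 => /(congr1 ( *%R^~ w)).
rewrite -mulrA ev_w mulr1 mul0r (fE _ ev _ ev_w) => /(congr1 ( *%R (w ^+ k))).
rewrite mulrA -exprMn mulrC [w * _]mulrC ev_w expr1n mulr1 mulr0 => <-.
have [e' e'E numE] := coord_numE ev_w; rewrite evE in e'E numE.
(* The factorization of g b returns g, as b is upper triangular. *)
have g2E : (g *m b) *m lead_inv e' (g *m b) = g.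
  rewrite -mulmxA; apply: lower_unip_mul_upper => //.
    by apply: upper_mul => //; exact: lead_inv_upper.
  by rewrite mulmxA; exact: mul_lead_inv_unip.
pose s1 : {rmorphism {mpolyT C[xvar n]} -> S} :=
  mmap (ev \o @mpolyC _ C) (fun i : 'I_#|xvar n| => w * ev (coord_num C h (enum_val i))).
suff : q =1 s1 by apply.
apply: varT_hom_ext => [c|u]; first by rewrite [RHS]mmapC; exact/esym/evC.
rewrite /s1 /= {2}/varT mmapX mmap1U enum_rankK numE g2E.
by case: u => -[i j] lt_ji; rewrite [RHS]mxE (gen_unip_xij _ lt_ji).
Qed.

Lemma idealHess_idealZ : indecomposable h -> [pchar C] =i pred0 ->
  idealZ C h =i idealHess C h.
Proof.
move=> indec char0 f; apply/idP/idP; first exact: idealZ_sub_Hess.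
exact: idealHess_sub_Z.
Qed.
End Reducedness.

Lemma presentation_iso (C : fieldType) m (h : hess_fun m.+1)
    (I0 I : idealr {mpolyT C[xvar m.+1]}) :
    I0 =i idealZ C h -> I =i idealZ C h ->
  exists (pres : {lrmorphism {ideal_quot I0} -> {ideal_quot I}})
         (phi : {lrmorphism {ideal_quot I} -> {ideal_quot idealE C h}}),
  [/\ bijective pres, forall f, pres (proj I0 f) = proj I f, bijective phi &
      forall (i j : 'I_m.+1) (lt_ji : (j < i)%N),
        phi (pres (proj I0 (xij C lt_ji)))
        = proj (idealE C h) (hE C h (leq_subr j.+1 m.+1) (i - j))].
Proof.
move=> I0Z IZ.
have I0I : I0 =i I by move=> f; rewrite I0Z IZ.
have [pres [bij_pres presE]] := quot_id I0I.
have memI f : (f \in I) = (substTL (hE_subst C h) f \in idealE C h).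
  by rewrite IZ subst_hE_idealZ.
have [phi [bij_phi phiE]] := quot_iso memI (@idealE_surj C m h).
exists pres, phi; split=> // i j lt_ji.
by rewrite presE phiE /= /xij substT_var.
Qed.

Theorem theorem4p13 (R : realType) (n : nat) (n_gt0 : (0 < n)%N)
    (h : hess_fun n) :
  (exists (pres : {lrmorphism {ideal_quot idealF R[i] h n.-1} ->
                              {ideal_quot idealZ R[i] h}})
          (phi : {lrmorphism {ideal_quot idealZ R[i] h} ->
                             {ideal_quot idealE R[i] h}}),
     [/\ bijective pres,
         forall f, pres (proj (idealF R[i] h n.-1) f)
                   = proj (idealZ R[i] h) f,
         bijective phi &
         forall (i j : 'I_n) (lt_ji : (j < i)%N),
           phi (pres (proj (idealF R[i] h n.-1) (xij R[i] lt_ji)))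
           = proj (idealE R[i] h) (hE R[i] h (leq_subr j.+1 n) (i - j))]) /\
  (indecomposable h ->
   exists (pres : {lrmorphism {ideal_quot idealF R[i] h n.-2} ->
                              {ideal_quot idealHess R[i] h}})
          (phi : {lrmorphism {ideal_quot idealHess R[i] h} ->
                             {ideal_quot idealE R[i] h}}),
     [/\ bijective pres,
         forall f, pres (proj (idealF R[i] h n.-2) f)
                   = proj (idealHess R[i] h) f,
         bijective phi &
         forall (i j : 'I_n) (lt_ji : (j < i)%N),
           phi (pres (proj (idealF R[i] h n.-2) (xij R[i] lt_ji)))
           = proj (idealE R[i] h) (hE R[i] h (leq_subr j.+1 n) (i - j))]).
Proof.
case: n n_gt0 h => [//|m] _ h.
have FZ := @idealF_idealZ R[i] m h.
have part1 := presentation_iso FZ (fun f => erefl (f \in idealZ R[i] h)).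
split; first exact: part1.
move=> indec.
have F2Z := @idealF2_idealZ R[i] m h indec.
have HZ f : (f \in idealHess R[i] h) = (f \in idealZ R[i] h).
  by rewrite (idealHess_idealZ indec) //; exact: Num.Theory.pchar_num.
exact: presentation_iso F2Z HZ.
Qed.
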